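(* In the elliptically symmetric deformation model $p(\bm x,\bm\theta)=|\Lambda|f(\Lambda(\bm x-\bm\mu))$ with $\Lambda$ symmetric positive definite, if $f$ is the standard Gaussian density $f(\bm z)=(2\pi)^{-d/2}e^{-\|\bm z\|^2/2}$, then for observations $\bm x_1,\dots,\bm x_n$ with positive definite sample covariance, the maximum likelihood estimator $\hat{\bm\theta}_F$ and the Wasserstein estimator $\hat{\bm\theta}_W$ coincide (both equal $(\bar{\bm x},\hat\Sigma^{-1/2})$ with $\bar{\bm x}$ the sample mean and $\hat\Sigma$ the sample covariance with divisor $n$).
   Context: The Wasserstein estimator $\hat{\bm\theta}_W$ is the solution of $\frac1n\sum_{t=1}^nS^W_k(\bm x_t,\bm\theta)=0$ for all parameters $\theta_k$, where the Wasserstein score $S^W_k$ solves $\nabla_{\bm x}\cdot(p(\bm x,\bm\theta)\nabla_{\bm x}S^W_k)=-\partial_{\theta_k}p(\bm x,\bm\theta)$ with $\mathrm{E}_{\bm\theta}[S^W_k]=0$. The maximum likelihood estimator $\hat{\bm\theta}_F$ solves $\frac1n\sum_t\partial_{\theta_k}\log p(\bm x_t,\bm\theta)=0$. *)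

(* Defs.v *)
From HB Require Import structures.
From mathcomp Require Import all_boot all_order all_algebra.
From mathcomp Require Import all_classical all_reals all_analysis.
Set Implicit Arguments. Unset Strict Implicit. Unset Printing Implicit Defensive.
Import Order.TTheory GRing.Theory Num.Theory.
Import numFieldNormedType.Exports.
Local Open Scope ring_scope.

Definition spd (R : realType) (d : nat) (A : 'M[R]_d) : Prop :=
  A^T = A /\ forall v : 'rV[R]_d, v != 0 -> 0 < (v *m A *m v^T) 0 0.

Definition gauss (R : realType) (d : nat) (z : 'rV[R]_d) : R :=
  (2 * pi) `^ (- (d%:R / 2)) * expR (- (\sum_(i < d) z 0 i ^+ 2) / 2).

(* Deformation model p(x, (mu, L)) = |L| f(L (x - mu)); L symmetric so
   L (x - mu) is written (x - mu) *m L in row convention. *)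
Definition pdens (R : realType) (d : nat) (f : 'rV[R]_d -> R)
    (x mu : 'rV[R]_d) (L : 'M[R]_d) : R :=
  \det L * f ((x - mu) *m L).

(* Parameter coordinates theta_k: mu_i (direction (e_i, 0)) and the
   entries L_ij, i <= j, of the symmetric matrix L
   (direction (0, E_ij + E_ji)). *)
Inductive param_index (d : nat) : Type :=
  | PMu of 'I_d
  | PLam (i j : 'I_d) of (i <= j)%N.

Definition pdir (R : realType) (d : nat) (k : param_index d)
  : 'rV[R]_d * 'M[R]_d :=
  match k with
  | PMu i => (delta_mx 0 i, 0)
  | PLam i j _ => (0, delta_mx i j + delta_mx j i)
  end.

Definition dtheta (R : realType) (d : nat) (g : 'rV[R]_d -> 'M[R]_d -> R)
    (k : param_index d) (mu : 'rV[R]_d) (L : 'M[R]_d) : R :=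
  derive1 (fun s : R => g (mu + s *: (pdir R k).1) (L + s *: (pdir R k).2)) 0.

Definition dx (R : realType) (d : nat) (i : 'I_d) (g : 'rV[R]_d -> R)
    (x : 'rV[R]_d) : R :=
  'D_(delta_mx 0 i) g x.

(* Lebesgue integral over R^d, written as an iterated integral of
   one-dimensional Lebesgue integrals (by Fubini/Tonelli this is the
   Lebesgue integral on R^d for the continuous functions used below). *)
Fixpoint iint (R : realType) (d : nat) : ('rV[R]_d -> \bar R) -> \bar R :=
  match d return ('rV[R]_d -> \bar R) -> \bar R with
  | 0 => fun g => g 0
  | d'.+1 => fun g =>
      (\int[@lebesgue_measure R]_(t in setT)
         iint (fun y : 'rV[R]_d' => g (row_mx (\row_(_ < 1) t) y)))%E
  end.

(* S is the Wasserstein score for theta_k at (mu, L) for the density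
   p = pdens f: a classical (twice differentiable) solution of
   div_x (p grad_x S) = - d_{theta_k} p, with E[S] = 0, taken in the
   natural class S in L^2(p), grad S in L^2(p) (where it is unique). *)
Definition wscore (R : realType) (d : nat) (f : 'rV[R]_d -> R)
    (k : param_index d) (mu : 'rV[R]_d) (L : 'M[R]_d)
    (S : 'rV[R]_d -> R) : Prop :=
  let p := fun y => pdens f y mu L in
  [/\ forall x, differentiable S x /\
        forall i, differentiable (dx i S) x,
      forall x, \sum_(i < d) dx i (fun y => p y * dx i S y) x
                = - dtheta (fun m l => pdens f x m l) k mu L,
      (iint (fun x => ((S x) ^+ 2 * p x)%:E) < +oo)%E,
      forall i, (iint (fun x => ((dx i S x) ^+ 2 * p x)%:E) < +oo)%E
    & iint (fun x => (S x * p x)%:E) = 0%E].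

Definition sample_mean (R : realType) (d n : nat) (X : 'I_n -> 'rV[R]_d)
  : 'rV[R]_d := n%:R^-1 *: \sum_(t < n) X t.

Definition sample_cov (R : realType) (d n : nat) (X : 'I_n -> 'rV[R]_d)
  : 'M[R]_d :=
  n%:R^-1 *: \sum_(t < n) ((X t - sample_mean X)^T *m (X t - sample_mean X)).

Definition is_mle (R : realType) (d n : nat) (f : 'rV[R]_d -> R)
    (X : 'I_n -> 'rV[R]_d) (mu : 'rV[R]_d) (L : 'M[R]_d) : Prop :=
  forall k : param_index d,
    n%:R^-1 * \sum_(t < n) dtheta (fun m l => ln (pdens f (X t) m l)) k mu L = 0.

Definition is_west (R : realType) (d n : nat) (f : 'rV[R]_d -> R)
    (X : 'I_n -> 'rV[R]_d) (mu : 'rV[R]_d) (L : 'M[R]_d) : Prop :=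
  forall k : param_index d, exists S : 'rV[R]_d -> R,
    wscore f k mu L S /\ n%:R^-1 * \sum_(t < n) S (X t) = 0.

(* Main.v *)
Require Import Defs.
From HB Require Import structures.
From mathcomp Require Import all_boot all_order all_algebra.
From mathcomp Require Import all_classical all_reals all_analysis.
From mathcomp Require Import perm measurable_realfun ring lra.
Import Order.TTheory GRing.Theory Num.Theory.
Import numFieldNormedType.Exports.
Set Implicit Arguments. Unset Strict Implicit. Unset Printing Implicit Defensive.
Local Open Scope classical_set_scope.
Local Open Scope ring_scope.

(* The Gaussian score and the Wasserstein score are both explicit polynomials of
   degree at most two in y = x - mu.  For the direction (m, E) of a coordinate
   theta_k and A = L^2,
     d_k log p = tr (L^-1 E) + y A m^T - y L E y^T,
     S_k = y m^T - (y B y^T - tr (B A^-1)) / 2  with  A B + B A = L E + E L,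
   where B exists and is unique because the Lyapunov operator of a positive
   definite matrix is bijective.  Averaging over the sample, the mean
   coordinates give mu = sample mean in both cases.  For the matrix coordinates,
   with M = Sigma - A^-1, the likelihood equations say L M + M L = 0, and the
   Wasserstein equations say that N L + L N = 0 for the solution N of
   A N + N A = M; both force M = 0.
     The substantial point is that S_k is the only score in the class considered.
   The difference h of two scores satisfies div (p grad h) = 0; testing against
   phi^2 h for a polynomial cutoff phi of the cube [-r, r]^d bounds the energy
   of h by C / r, so h is constant, and the zero mean makes it vanish.  Since h
   is only twice differentiable, the second derivatives need not be integrable,
   and the divergence theorem is proved by Goursat's bisection argument, which
   uses only pointwise differentiability of the field and continuity of its
   divergence. *)

(** * Integrals over a segment *)

(** [wscore] integrates by nested one-dimensional integrals, and for an arbitrary score the inner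
    integrals are not known to be measurable, so additivity of [iint] is not at hand. Estimates are
    therefore made on cubes, for continuous integrands, with the nested integral [boxI]; a finite
    [iint] enters only as a bound uniform in the cube. Equality of [iint] with the limit over
    growing cubes is established under Gaussian domination, and an unknown score falls under it once
    it is explicit up to a constant. The rate 1 / r comes from the cutoff, whose gradient is O(1 /
    r) on [-r, r]^d. Since h and grad h are both square integrable against p, the cross term phi h
    (grad phi . grad h) is bounded outright and nothing has to be absorbed into the energy. No
    Gaussian moment is computed: S_k p is itself the divergence of an affine field times p, and its
    flux through the faces of large cubes tends to 0. *)

Section SegmentIntegral.
Context {R : realType}.
Implicit Types (f g : R -> R) (a b c : R).

Definition segI a b f : R := \int[@lebesgue_measure R]_(t in `[a, b]) f t.

Lemma segI_integrable a b f : continuous f ->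
  (@lebesgue_measure R).-integrable `[a, b] (EFin \o f).
Proof.
move=> cf; apply: continuous_compact_integrable; first exact: segment_compact.
exact: continuous_subspaceT.
Qed.

Lemma eq_segI a b f g : (forall t, a <= t <= b -> f t = g t) ->
  segI a b f = segI a b g.
Proof. by move=> fg; apply: eq_Rintegral => t; rewrite inE/= in_itv/= => /fg. Qed.

Lemma segID a b f g : continuous f -> continuous g ->
  segI a b (fun t => f t + g t) = segI a b f + segI a b g.
Proof. by move=> cf cg; apply: RintegralD => //; exact: segI_integrable. Qed.

Lemma segIZ a b k f : continuous f ->
  segI a b (fun t => k * f t) = k * segI a b f.
Proof. by move=> cf; apply: RintegralZl => //; exact: segI_integrable. Qed.

Lemma le_segI a b f g : continuous f -> continuous g ->
  (forall t, a <= t <= b -> f t <= g t) -> segI a b f <= segI a b g.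
Proof.
move=> cf cg fg; apply: le_Rintegral => //; exact: segI_integrable.
Qed.

Lemma segI_cst a b k : a <= b -> segI a b (fun=> k) = k * (b - a).
Proof.
move=> ab; rewrite /segI Rintegral_cst//=.
have /= -> := @lebesgue_measure_itv R `[a, b]; rewrite lte_fin.
case: ltP => [_|ba] //=.
have -> : a = b by apply/eqP; rewrite eq_le ab ba.
by rewrite subrr.
Qed.

Lemma segI_norm_le a b M f : a <= b -> continuous f ->
  (forall t, a <= t <= b -> `|f t| <= M) -> `|segI a b f| <= M * (b - a).
Proof.
move=> ab cf fM; rewrite ler_norml; apply/andP; split.
  rewrite -mulNr -segI_cst//; apply: le_segI => //; first by move=> ?; exact: cst_continuous.
  by move=> t /fM; rewrite ler_norml => /andP[].
rewrite -segI_cst//; apply: le_segI => //; first by move=> ?; exact: cst_continuous.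
by move=> t /fM; rewrite ler_norml => /andP[].
Qed.

Lemma segI_split a b c f : continuous f -> a <= c -> c <= b ->
  segI a b f = segI a c f + segI c b f.
Proof.
move=> cf ac cb; rewrite /segI.
have := @Rintegral_itvB R f (BLeft a) (BRight b) c (segI_integrable _ _ cf).
rewrite !bnd_simp => /(_ ac cb) h.
have <- : \int[@lebesgue_measure R]_(t in `]c, b]) f t =
    \int[@lebesgue_measure R]_(t in `[c, b]) f t.
  apply: Rintegral_itv_obnd_cbnd.
  apply: integrableS (segI_integrable c b cf) => //.
  by move=> t; rewrite /= !in_itv/= => /andP[/ltW -> ->].
by rewrite -h; ring.
Qed.

Lemma segI_ge0 a b f : (forall t, a <= t <= b -> 0 <= f t) -> 0 <= segI a b f.
Proof. by move=> f0; apply: Rintegral_ge0 => t; rewrite /= in_itv/= => /f0. Qed.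

Lemma segI_affine a b f : continuous f -> a < b ->
  segI a b f = (b - a) * segI 0 1 (fun u => f (a + (b - a) * u)).
Proof.
move=> cf ab.
pose F u := a + (b - a) * u.
have Fd (u : R) : is_derive u 1 F (b - a).
  by apply: is_derive_eq; rewrite /GRing.scale/=; ring.
have F' : F^`()%classic = cst (b - a).
  by apply/funext => u; rewrite derive1E derive_val.
have cF : continuous F.
  by move=> u; apply: differentiable_continuous; apply/derivable1_diffP.
rewrite -segIZ; last by move=> u; apply: (continuous_comp (cF u)); exact: cf.
rewrite /segI /Rintegral; congr fine.
have Fa : a = F 0 by rewrite /F mulr0 addr0.
have Fb : b = F 1 by rewrite /F; ring.
rewrite [in LHS]Fa [in LHS]Fb.
rewrite integration_by_substitution_increasing//.
- apply: eq_integral => u _ /=; rewrite F'/= /F; congr (_%:E); rewrite mulrC.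
  by congr (_ * f _); ring.
- by move=> x y _ _ xy; rewrite /F; nra.
- by rewrite F' => ? _; exact: cst_continuous.
- by rewrite F'; exact: is_cvg_cst.
- by rewrite F'; exact: is_cvg_cst.
- split.
  + by move=> x _; exact: ex_derive.
  + by apply: cvg_at_right_filter; exact: cF.
  + by apply: cvg_at_left_filter; exact: cF.
- exact: continuous_subspaceT.
Qed.

Lemma segI_bisect f : continuous f ->
  segI 0 1 f = 2^-1 * (segI 0 1 (fun u => f (u / 2)) + segI 0 1 (fun u => f ((u + 1) / 2))).
Proof.
move=> cf.
have h0 : 0 < 2^-1 :> R by lra.
have h1 : 2^-1 < 1 :> R by lra.
rewrite (segI_split cf (ltW h0) (ltW h1)) (segI_affine cf h0) (segI_affine cf h1).
rewrite mulrDr; congr (_ * _ + _ * _).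
- by rewrite subr0.
- by apply: eq_segI => t _; congr f; rewrite subr0 add0r mulrC.
- by field.
- by apply: eq_segI => t _; congr f; field.
Qed.

Lemma segI_sub_le a b a' b' f : continuous f -> (forall t, 0 <= f t) ->
  a' <= a -> a <= b -> b <= b' -> segI a b f <= segI a' b' f.
Proof.
move=> cf f0 a'a ab bb'.
rewrite (segI_split cf a'a (le_trans ab bb')) (segI_split cf ab bb').
have h1 : 0 <= segI a' a f by exact: segI_ge0.
have h2 : 0 <= segI b b' f by exact: segI_ge0.
lra.
Qed.

Lemma segI_eq0 a b f : continuous f -> (forall t, 0 <= f t) ->
  segI a b f = 0 -> forall t, a < t < b -> f t = 0.
Proof.
move=> cf f0 If t /andP[at_ tb]; apply/eqP; apply/negPn/negP => ft.
have {}ft : 0 < f t by rewrite lt_neqAle eq_sym ft f0.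
have : \forall s \near t, f t / 2 < f s.
  by have /cvgr_gt := cf t; apply; lra.
move=> /nbhs_ballP[e /= e0 He].
(* The half keeps the closed segment [[t - d, t + d]] inside the open ball on which [f > f t / 2];
   the other two terms keep it inside [[a, b]]. *)
pose d := Num.min (e / 2) (Num.min (t - a) (b - t)).
have d0 : 0 < d by rewrite !lt_min; apply/andP; split; [lra|apply/andP; split; lra].
have [de [da db]] : d <= e / 2 /\ d <= t - a /\ d <= b - t.
  by rewrite /d; repeat split; rewrite ?ge_min ?lexx ?orbT.
have : f t / 2 * ((t + d) - (t - d)) <= segI (t - d) (t + d) f.
  rewrite -segI_cst; last lra.
  apply: le_segI => //; first by move=> ?; exact: cst_continuous.
  move=> s /andP[s1 s2]; apply/ltW/He; rewrite /ball/= ltr_norml; apply/andP; split; lra.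
have := @segI_sub_le (t - d) (t + d) a b f cf f0.
rewrite If => /(_ _ _ _) h; have {}h := h ltac:(lra) ltac:(lra) ltac:(lra).
nra.
Qed.

(** Compactness of the segment makes joint continuity uniform in the integration variable. [T] is
    arbitrary because the induction in [boxI_continuous] moves coordinates into the parameter
    space. *)
Lemma segI_continuous (T : topologicalType) a b (k : T -> R -> R) :
  a <= b -> continuous (fun z : T * R => k z.1 z.2) ->
  continuous (fun t => segI a b (k t)).
Proof.
move=> ab ck t0.
have ckt t : continuous (k t).
  move=> s; apply: (@continuous_comp _ _ _ (fun s => (t, s)) (fun z : T * R => k z.1 z.2)).
    exact: (cvg_pair (cvg_cst t) cvg_id).
  exact: ck.
apply/cvgrPdist_le => e e0.
(* The added 1 keeps the denominator positive when [a = b]. *)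
have e'0 : 0 < e / (b - a + 1) by apply: divr_gt0 => //; lra.
pose P t s := `|k t0 s - k t s| <= e / (b - a + 1).
have HP s : `[a, b]%classic s -> \forall s' \near s & t \near t0, P t s'.
  move=> _.
  have e2 : 0 < e / (b - a + 1) / 2 by lra.
  have /cvgr_dist_le/(_ _ e2) [[U V] /= [tU sV] H2] := ck (t0, s).
  have /cvgr_dist_le/(_ _ e2) H1 := ckt t0 s.
  near=> s' t.
  have h1 : `|k t0 s - k t0 s'| <= e / (b - a + 1) / 2 by near: s'.
  have h2 : `|k t0 s - k t s'| <= e / (b - a + 1) / 2.
    by apply: (H2 (t, s')); split => /=; [near: t | near: s'].
  move: h1 h2; rewrite /P; set x := k t0 s; set y := k t0 s'; set z := k t s'.
  rewrite !ler_norml => /andP[? ?] /andP[? ?]; apply/andP; split; lra.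
have /compact_near_coveringP/(_ _ (nbhs t0) P _ HP) tP := @segment_compact R a b.
near=> t.
have ckN : continuous (fun s => -1 * k t s).
  by move=> s; apply: cvgM; [exact: cvg_cst|exact: ckt].
have -> : segI a b (k t0) - segI a b (k t) = segI a b (fun s => k t0 s + -1 * k t s).
  by rewrite segID// segIZ//; ring.
apply: (@le_trans _ _ (e / (b - a + 1) * (b - a))).
  apply: segI_norm_le => //; first by move=> s; apply: cvgD; [exact: ckt|exact: ckN].
  move=> s sab; rewrite mulN1r.
  by apply: (near tP t) => //; rewrite /= in_itv.
rewrite mulrAC ler_pdivrMr; nra.
Unshelve. all: by end_near. Qed.

End SegmentIntegral.

(** * Iterated integrals over a cube *)

Section BoxIntegral.
Context {R : realType}.

Lemma continuous_mx (T : topologicalType) m n (f : T -> 'M[R]_(m, n)) :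
  (forall i j, continuous (fun x => f x i j)) -> continuous f.
Proof.
move=> cf x A [P MP sPA].
have : \forall y \near x, forall i j, P i j (f y i j).
  by do 2!apply: filter_forall => ?; apply: cf; exact: MP.
by apply: filterS => y Py; apply: sPA => i j; exact: Py.
Qed.

Lemma continuous_entry (T : topologicalType) m n (f : T -> 'M[R]_(m, n)) i j :
  continuous f -> continuous (fun x => f x i j).
Proof.
move=> cf x; apply: (@continuous_comp _ _ _ f (fun M : 'M[R]_(m, n) => M i j)).
  exact: cf.
exact: coord_continuous.
Qed.

Section RealContinuity.
Context (T : topologicalType).
Implicit Types f g : T -> R.

Lemma continuous_cst (k : R) : continuous (fun _ : T => k).
Proof. by move=> x; exact: cvg_cst. Qed.

Lemma continuous_add f g : continuous f -> continuous g ->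
  continuous (fun x => f x + g x).
Proof. by move=> cf cg x; apply: cvgD; [exact: cf|exact: cg]. Qed.

Lemma continuous_mul f g : continuous f -> continuous g ->
  continuous (fun x => f x * g x).
Proof. by move=> cf cg x; apply: cvgM; [exact: cf|exact: cg]. Qed.

Lemma continuous_opp f : continuous f -> continuous (fun x => - f x).
Proof. by move=> cf x; apply: cvgN; exact: cf. Qed.

Lemma continuous_sum (I : Type) (r : seq I) (P : pred I) (F : I -> T -> R) :
  (forall i, continuous (F i)) -> continuous (fun x => \sum_(i <- r | P i) F i x).
Proof.
move=> cF; elim: r => [|i r IH].
  by under eq_fun do rewrite big_nil; exact: continuous_cst.
under eq_fun do rewrite big_cons.
by case: (P i) => //; exact: continuous_add.
Qed.
End RealContinuity.

Lemma continuous_comp2 (T U V W : topologicalType) (f : T -> U) (h : T -> V)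
    (g : U -> V -> W) : continuous f -> continuous h ->
  continuous (fun z : U * V => g z.1 z.2) -> continuous (fun t => g (f t) (h t)).
Proof.
move=> cf ch cg t.
apply: (@continuous_comp _ _ _ (fun t => (f t, h t)) (fun z : U * V => g z.1 z.2)).
  exact: (cvg_pair (cf t) (ch t)).
exact: cg.
Qed.

(** Literally the row built inside [iint], so that [boxI] and [iint] peel off the same
    coordinate. *)
Definition vcons d (t : R) (y : 'rV[R]_d) : 'rV[R]_d.+1 :=
  row_mx (\row_(_ < 1) t) y.

Lemma vcons0 d t (y : 'rV[R]_d) : vcons t y 0 ord0 = t.
Proof.
have -> : ord0 = lshift d (0 : 'I_1) by exact/val_inj.
by rewrite /vcons (@row_mxEl R 1 1 d) mxE.
Qed.

Lemma vconsS d t (y : 'rV[R]_d) i : vcons t y 0 (lift ord0 i) = y 0 i.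
Proof.
have -> : lift ord0 i = rshift 1 i by exact/val_inj.
by rewrite /vcons (@row_mxEr R 1 1 d).
Qed.

Lemma rV_vcons d (x : 'rV[R]_d.+1) :
  x = vcons (x 0 ord0) (\row_i x 0 (lift ord0 i)).
Proof.
by apply/rowP => i; case: (unliftP ord0 i) => [j ->|->]; rewrite ?vcons0 ?vconsS ?mxE.
Qed.

Lemma continuous_vcons (T : topologicalType) d (f : T -> R) (g : T -> 'rV[R]_d) :
  continuous f -> continuous g -> continuous (fun z => vcons (f z) (g z)).
Proof.
move=> cf cg; apply: continuous_mx => i j; rewrite (ord1 i).
case: (unliftP ord0 j) => [k|] ->.
  rewrite (_ : (fun z => _) = (fun z => g z 0 k)).
    exact: continuous_entry.
  by apply/funext => z; rewrite vconsS.
by rewrite (_ : (fun z => _) = f)//; apply/funext => z; rewrite vcons0.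
Qed.

Definition inbox a b d (x : 'rV[R]_d) := forall i, a <= x 0 i <= b.

Lemma inbox_vcons a b d t (y : 'rV[R]_d) :
  a <= t <= b -> inbox a b y -> inbox a b (vcons t y).
Proof.
by move=> tab yab i; case: (unliftP ord0 i) => [j ->|->]; rewrite ?vcons0 ?vconsS.
Qed.

(** The recursion copies that of [iint]: the two integrals are compared one coordinate at a time,
    without Fubini. *)
Fixpoint boxI a b d : ('rV[R]_d -> R) -> R :=
  match d return ('rV[R]_d -> R) -> R with
  | 0 => fun g => g 0
  | d'.+1 => fun g => segI a b (fun t => boxI a b (fun y : 'rV[R]_d' => g (vcons t y)))
  end.

Lemma eq_boxI a b d (f g : 'rV[R]_d -> R) :
  (forall x, inbox a b x -> f x = g x) -> boxI a b f = boxI a b g.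
Proof.
elim: d f g => [|d IH] f g fg /=; first by apply: fg => -[].
apply: eq_segI => t tab; apply: IH => y yab; apply: fg; exact: inbox_vcons.
Qed.

Lemma boxI_continuous a b (T : topologicalType) d (g : T -> 'rV[R]_d -> R) :
  a <= b -> continuous (fun z : T * 'rV[R]_d => g z.1 z.2) ->
  continuous (fun t => boxI a b (g t)).
Proof.
move=> ab; elim: d T g => [|d IH] T g cg /=.
  by apply: (continuous_comp2 _ _ cg) => t; [exact: cvg_id|exact: cvg_cst].
apply: (@segI_continuous _ _ _ _ (fun t s => boxI a b (fun y => g t (vcons s y)))) => //.
apply: (IH _ (fun (z : T * R) y => g z.1 (vcons z.2 y))).
apply: (@continuous_comp2 _ _ _ _ (fun z : (T * R) * 'rV[R]_d => z.1.1)
  (fun z => vcons z.1.2 z.2) g) => //.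
  by move=> z; apply: (cvg_comp fst fst); exact: cvg_fst.
apply: (@continuous_vcons _ _ (fun z : (T * R) * 'rV[R]_d => z.1.2) snd).
  by move=> w; apply: (cvg_comp fst snd); [exact: cvg_fst|exact: cvg_snd].
by move=> w; exact: cvg_snd.
Qed.

Lemma continuous_slice d (g : 'rV[R]_d.+1 -> R) t :
  continuous g -> continuous (fun y => g (vcons t y)).
Proof.
move=> cg y; apply: (@continuous_comp _ _ _ (vcons t)); last exact: cg.
by apply: (@continuous_vcons _ _ (fun=> t) id) => ?; [exact: cst_continuous|exact: cvg_id].
Qed.

Lemma continuous_boxI_slice a b d (g : 'rV[R]_d.+1 -> R) : a <= b ->
  continuous g -> continuous (fun t => boxI a b (fun y => g (vcons t y))).
Proof.
move=> ab cg; apply: (boxI_continuous ab) => z.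
apply: (@continuous_comp _ _ _ (fun z : R * 'rV[R]_d => vcons z.1 z.2)); last exact: cg.
by apply: (@continuous_vcons _ _ fst snd) => ?; [exact: cvg_fst|exact: cvg_snd].
Qed.

Section Basic.
Context {a b : R} (ab : a <= b).

Lemma boxID d (f g : 'rV[R]_d -> R) : continuous f -> continuous g ->
  boxI a b (fun x => f x + g x) = boxI a b f + boxI a b g.
Proof.
elim: d f g => [|d IH] f g cf cg //=.
rewrite -segID; [|exact: continuous_boxI_slice|exact: continuous_boxI_slice].
by apply: eq_segI => t _; apply: IH; exact: continuous_slice.
Qed.

Lemma boxIZ d k (f : 'rV[R]_d -> R) : continuous f ->
  boxI a b (fun x => k * f x) = k * boxI a b f.
Proof.
elim: d f => [|d IH] f cf //=.
rewrite -segIZ; last exact: continuous_boxI_slice.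
by apply: eq_segI => t _; apply: IH; exact: continuous_slice.
Qed.

Lemma le_boxI d (f g : 'rV[R]_d -> R) : continuous f -> continuous g ->
  (forall x, inbox a b x -> f x <= g x) -> boxI a b f <= boxI a b g.
Proof.
elim: d f g => [|d IH] f g cf cg fg /=; first by apply: fg => -[].
apply: le_segI; [exact: continuous_boxI_slice|exact: continuous_boxI_slice|].
move=> t tab; apply: IH; [exact: continuous_slice|exact: continuous_slice|].
move=> y yab; apply: fg; exact: inbox_vcons.
Qed.

Lemma boxI_cst d k : boxI a b (fun _ : 'rV[R]_d => k) = k * (b - a) ^+ d.
Proof.
elim: d => [|d IH] /=; first by rewrite mulr1.
by rewrite IH segI_cst// exprSr mulrA.
Qed.

Lemma boxI_norm_le d M (f : 'rV[R]_d -> R) : continuous f ->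
  (forall x, inbox a b x -> `|f x| <= M) -> `|boxI a b f| <= M * (b - a) ^+ d.
Proof.
move=> cf fM; rewrite ler_norml -mulNr -!boxI_cst; apply/andP; split.
  apply: le_boxI => // [?|x /fM]; first exact: cst_continuous.
  by rewrite ler_norml => /andP[].
apply: le_boxI => // [?|x /fM]; first exact: cst_continuous.
by rewrite ler_norml => /andP[].
Qed.

Lemma boxI_ge0 d (f : 'rV[R]_d -> R) :
  (forall x, inbox a b x -> 0 <= f x) -> 0 <= boxI a b f.
Proof.
elim: d f => [|d IH] f f0 /=; first by apply: f0 => -[].
by apply: segI_ge0 => t tab; apply: IH => y yab; apply: f0; exact: inbox_vcons.
Qed.

End Basic.

Lemma boxI_affine a b d (f : 'rV[R]_d -> R) : a < b -> continuous f ->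
  boxI a b f = (b - a) ^+ d * boxI 0 1 (fun u => f (const_mx a + (b - a) *: u)).
Proof.
move=> ab; elim: d f => [|d IH] f cf /=.
  by rewrite mul1r; congr f; apply/rowP => -[].
rewrite segI_affine//; last by apply: continuous_boxI_slice => //; exact: ltW.
rewrite exprS -mulrA; congr (_ * _).
have ch : continuous (fun u : 'rV_d.+1 => f (const_mx a + (b - a) *: u)).
  move=> u; apply: (@continuous_comp _ _ _ (fun u : 'rV_d.+1 => const_mx a + (b - a) *: u)); last exact: cf.
  apply: continuous_mx => i j.
  rewrite (_ : (fun u => _) = (fun u : 'rV[R]_d.+1 => a + (b - a) * u i j)).
    apply: continuous_add; first exact: continuous_cst.
    apply: continuous_mul; [exact: continuous_cst|exact: coord_continuous].
  by apply/funext => w; rewrite !mxE.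
rewrite -segIZ; last by apply: (continuous_boxI_slice _ ch).
apply: eq_segI => u _; rewrite IH; last exact: continuous_slice.
congr (_ * _); apply: eq_boxI => y _; congr f.
apply/rowP => i.
have E (x : 'rV[R]_d.+1) k : (const_mx a + (b - a) *: x) 0 k = a + (b - a) * x 0 k.
  by rewrite !mxE.
case: (unliftP ord0 i) => [j ->|->]; rewrite E ?vcons0 ?vconsS //.
by rewrite !mxE.
Qed.

Definition vset d (x : 'rV[R]_d) (i : 'I_d) (t : R) : 'rV[R]_d :=
  \row_j (if j == i then t else x 0 j).

Lemma vset_vcons0 d s (y : 'rV[R]_d) t : vset (vcons s y) ord0 t = vcons t y.
Proof.
apply/rowP => j; rewrite mxE.
by case: (unliftP ord0 j) => [k ->|->]; rewrite ?vcons0 ?vconsS.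
Qed.

Lemma vset_vconsS d s (y : 'rV[R]_d) i t :
  vset (vcons s y) (lift ord0 i) t = vcons s (vset y i t).
Proof.
apply/rowP => j; rewrite mxE.
case: (unliftP ord0 j) => [k ->|->]; rewrite ?vcons0 ?vconsS ?mxE //.
Qed.

Lemma continuous_vset (T : topologicalType) d (f : T -> 'rV[R]_d) i (t : T -> R) :
  continuous f -> continuous t -> continuous (fun x => vset (f x) i (t x)).
Proof.
move=> cf ct; apply: continuous_mx => k j; rewrite ord1.
case: (eqVneq j i) => [->|ji].
  by rewrite (_ : (fun x => _) = t)//; apply/funext => x; rewrite mxE eqxx.
rewrite (_ : (fun x => _) = (fun x => f x 0 j)).
  exact: continuous_entry.
by apply/funext => x; rewrite mxE (negbTE ji).
Qed.

(** For [e] equal to 0 or 1, the affine map of the unit cube onto its lower or upper half in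
    direction [i]. *)
Definition vhalf d (i : 'I_d) (e : R) (u : 'rV[R]_d) := vset u i ((u 0 i + e) / 2).

Lemma continuous_vhalf d (i : 'I_d) e : continuous (vhalf i e).
Proof.
apply: continuous_vset; first by move=> u; exact: cvg_id.
apply: continuous_mul; last exact: continuous_cst.
apply: continuous_add; last exact: continuous_cst.
exact: coord_continuous.
Qed.

Lemma boxI_bisect d (i : 'I_d) (f : 'rV[R]_d -> R) : continuous f ->
  boxI 0 1 f = 2^-1 * (boxI 0 1 (fun u => f (vhalf i 0 u)) +
                       boxI 0 1 (fun u => f (vhalf i 1 u))).
Proof.
elim: d i f => [|d IH] i f cf /=; first by case: i.
have chalf e : continuous (fun u => f (vhalf i e u)).
  by move=> u; apply: continuous_comp; [exact: continuous_vhalf|exact: cf].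
case: (unliftP ord0 i) => [j|] ij; subst i.
  rewrite -segID; [|exact: (continuous_boxI_slice ler01 (chalf 0))|
                    exact: (continuous_boxI_slice ler01 (chalf 1))].
  rewrite -segIZ; last first.
    by move=> t; apply: cvgD; exact: (continuous_boxI_slice ler01 (chalf _)).
  apply: eq_segI => t _; rewrite (IH j); last exact: continuous_slice.
  congr (_ * (_ + _)); apply: eq_boxI => y _; congr f;
    by rewrite /vhalf vset_vconsS vconsS.
rewrite segI_bisect; last exact: continuous_boxI_slice.
congr (_ * (_ + _)); apply: eq_segI => t _; apply: eq_boxI => y _; congr f;
  by rewrite /vhalf vset_vcons0 vcons0 ?addr0.
Qed.

Lemma boxI_sub_le a b a' b' d (f : 'rV[R]_d -> R) : continuous f ->
  (forall x, 0 <= f x) -> a' <= a -> a <= b -> b <= b' ->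
  boxI a b f <= boxI a' b' f.
Proof.
move=> cf f0 a'a ab bb'.
have ab' : a' <= b' by lra.
elim: d f cf f0 => [|d IH] f cf f0 //=.
apply: (@le_trans _ _ (segI a b (fun t => boxI a' b' (fun y => f (vcons t y))))).
  apply: le_segI; [exact: continuous_boxI_slice|exact: continuous_boxI_slice|].
  by move=> t _; apply: IH => //; exact: continuous_slice.
apply: segI_sub_le => //; first exact: continuous_boxI_slice.
by move=> t; apply: boxI_ge0.
Qed.

Lemma boxI_eq0 a b d (f : 'rV[R]_d -> R) : a <= b -> continuous f ->
  (forall x, 0 <= f x) -> boxI a b f = 0 ->
  forall x : 'rV[R]_d, (forall i, a < x 0 i < b) -> f x = 0.
Proof.
move=> ab; elim: d f => [|d IH] f cf f0 /=.
  by move=> + x _; congr (f _ = 0); apply/rowP => -[].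
move=> If x xab; rewrite (rV_vcons x).
apply: (IH (fun y => f (vcons (x 0 ord0) y))) => //; first exact: continuous_slice.
  apply: (segI_eq0 _ _ If (xab ord0)); first exact: continuous_boxI_slice.
  by move=> t; apply: boxI_ge0.
by move=> i; rewrite mxE.
Qed.

End BoxIntegral.

(** * Divergence theorem by bisection *)

Section Divergence.
Context {R : realType} {d : nat}.
Implicit Types (a s u x : 'rV[R]_d) (i j : 'I_d).

Definition boxpt a s u : 'rV[R]_d := \row_j (a 0 j + s 0 j * u 0 j).

Lemma continuous_boxpt (T : topologicalType) a s (f : T -> 'rV[R]_d) :
  continuous f -> continuous (fun z => boxpt a s (f z)).
Proof.
move=> cf; apply: continuous_mx => i j.
under eq_fun do rewrite mxE.
apply: continuous_add; first exact: continuous_cst.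
apply: continuous_mul; first exact: continuous_cst.
exact: continuous_entry.
Qed.

Context (F : 'I_d -> 'rV[R]_d -> R) (D : 'rV[R]_d -> R).

(* Outward flux divided by the volume.  The i-th term does not depend on u_i, so
   integrating over all d coordinates replaces integration over a face. *)
Definition boxflux a s u : R :=
  \sum_i (s 0 i)^-1 * (F i (boxpt a s (vset u i 1)) - F i (boxpt a s (vset u i 0))).

(** Failure of the divergence theorem on the box with corner [a] and sides [s], per unit volume.
    With this normalisation bisection averages the defects, so one half is always at least as bad as
    the whole. *)
Definition boxdefect a s : R :=
  boxI 0 1 (fun u => boxflux a s u - D (boxpt a s u)).

Context (cF : forall i, continuous (F i)) (cD : continuous D).

Lemma continuous_boxflux a s : continuous (boxflux a s).
Proof.
apply: continuous_sum => i; apply: continuous_mul; first exact: continuous_cst.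
have h c : continuous (fun u => F i (boxpt a s (vset u i c))).
  move=> u; apply: (@continuous_comp _ _ _ (fun u => boxpt a s (vset u i c))); last exact: cF.
  apply: continuous_boxpt; apply: continuous_vset; last exact: continuous_cst.
  by move=> v; exact: cvg_id.
by apply: continuous_add => //; exact: continuous_opp.
Qed.

Lemma continuous_boxdefect_integrand a s :
  continuous (fun u => boxflux a s u - D (boxpt a s u)).
Proof.
apply: continuous_add; first exact: continuous_boxflux.
apply: continuous_opp => u.
apply: (@continuous_comp _ _ _ (fun u => boxpt a s u)); last exact: cD.
by apply: continuous_boxpt => v; exact: cvg_id.
Qed.

Lemma boxdefect_bisect a s j : s 0 j != 0 ->
  boxdefect a s = 2^-1 * (boxdefect a (vset s j (s 0 j / 2)) +
    boxdefect (vset a j (a 0 j + s 0 j / 2)) (vset s j (s 0 j / 2))).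
Proof.
move=> sj.
set s' := vset s j _; set a' := vset a j _.
have ch := continuous_boxdefect_integrand.
have chh e : continuous (fun u => boxflux a s (vhalf j e u) - D (boxpt a s (vhalf j e u))).
  move=> u; apply: (@continuous_comp _ _ _ (vhalf j e) (fun u => boxflux a s u - D (boxpt a s u))).
    exact: continuous_vhalf.
  exact: ch.
rewrite /boxdefect (boxI_bisect j (ch a s)).
rewrite -(boxID ler01 (chh 0) (chh 1)) -(boxID ler01 (ch a s') (ch a' s')).
congr (_ * _); apply: eq_boxI => u _.
have p0 : boxpt a s (vhalf j 0 u) = boxpt a s' u.
  by apply/rowP => k; rewrite !mxE; case: eqP => [->|] //; field.
have p1 : boxpt a s (vhalf j 1 u) = boxpt a' s' u.
  by apply/rowP => k; rewrite !mxE; case: eqP => [->|] //; field.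
rewrite p0 p1.
suff E : boxflux a s (vhalf j 0 u) + boxflux a s (vhalf j 1 u) =
          boxflux a s' u + boxflux a' s' u by lra.
rewrite /boxflux -!big_split/=; apply: eq_bigr => i _.
(* The faces orthogonal to another direction are cut exactly as the box is, and the terms agree one
   by one. In direction [j] the face shared by the two halves occurs with opposite signs and
   cancels. *)
have [ij|ij] := eqVneq i j; last first.
  have -> : s' 0 i = s 0 i by rewrite mxE (negbTE ij).
  have q0 c : boxpt a s (vset (vhalf j 0 u) i c) = boxpt a s' (vset u i c).
    apply/rowP => k; rewrite !mxE; have [ki|ki] := eqVneq k i.
      by rewrite ki (negbTE ij).
    by case: eqP => [->|] //; field.
  have q1 c : boxpt a s (vset (vhalf j 1 u) i c) = boxpt a' s' (vset u i c).
    apply/rowP => k; rewrite !mxE; have [ki|ki] := eqVneq k i.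
      by rewrite ki (negbTE ij).
    by case: eqP => [->|] //; field.
  by rewrite !q0 !q1.
subst i.
have -> : s' 0 j = s 0 j / 2 by rewrite mxE eqxx.
have r e c : boxpt a s (vset (vhalf j e u) j c) = boxpt a s (vset u j c).
  by apply/rowP => k; rewrite !mxE; case: eqP.
have r0 : boxpt a s' (vset u j 0) = boxpt a s (vset u j 0).
  by apply/rowP => k; rewrite !mxE; case: eqP => [->|] //; rewrite !mulr0.
have r1 : boxpt a' s' (vset u j 1) = boxpt a s (vset u j 1).
  by apply/rowP => k; rewrite !mxE; case: eqP => [->|] //; field.
have rh : boxpt a' s' (vset u j 0) = boxpt a s' (vset u j 1).
  by apply/rowP => k; rewrite !mxE; case: eqP => [->|] //; field.
rewrite !r r0 r1 rh; field.
exact: sj.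
Qed.

Lemma boxdefect_child a (s : R) (e : R) : 0 < s ->
  e < `|boxdefect a (const_mx s)| ->
  exists a', e < `|boxdefect a' (const_mx (s / 2))| /\
    forall i, a 0 i <= a' 0 i <= a 0 i + s / 2.
Proof.
move=> s0 He.
(* The sides once the first [m] directions are halved. The intermediate boxes are not cubes, which
   is why [boxdefect] takes a vector of sides. *)
pose S m : 'rV[R]_d := \row_i (if (i < m)%N then s / 2 else s).
suff /(_ d (leqnn d)) [a' [h1 h2]] : forall m, (m <= d)%N ->
    exists a', e < `|boxdefect a' (S m)| /\
      forall i, a 0 i <= a' 0 i <= a 0 i + (s - S m 0 i).
  exists a'; split.
    suff <- : S d = const_mx (s / 2) by [].
    by apply/rowP => i; rewrite !mxE ltn_ord.
  by move=> i; have := h2 i; rewrite !mxE ltn_ord; lra.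
elim=> [_|m IH md].
  exists a; split => [|i]; last by rewrite mxE ltn0; lra.
  suff -> : S 0 = const_mx s by [].
  by apply/rowP => i; rewrite !mxE.
have [a' [h1 h2]] := IH (ltnW md).
pose j := Ordinal md.
have Sj : S m 0 j = s by rewrite mxE ltnn.
have SS : S m.+1 = vset (S m) j (S m 0 j / 2).
  rewrite Sj; apply/rowP => i; rewrite !mxE -val_eqE /= ltnS leq_eqVlt.
  by case: eqP => [->|].
have sj0 : S m 0 j != 0 by rewrite Sj gt_eqF.
have := boxdefect_bisect a' sj0; rewrite -SS.
set a'' := vset a' _ _ => EE.
have [l|r] := ltP e `|boxdefect a' (S m.+1)|.
  exists a'; split => // i; have := h2 i; rewrite !mxE ltnS.
  by case: (ltngtP i m) => _; lra.
exists a''; split.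
  rewrite ltNge; apply/negP => r'.
  move: h1; rewrite EE normrM ger0_norm; last lra.
  have := ler_normD (boxdefect a' (S m.+1)) (boxdefect a'' (S m.+1)).
  lra.
move=> i; have := h2 i; rewrite /a'' Sj !mxE.
have -> : (i < m.+1)%N = (i == m :> nat) || (i < m)%N by rewrite ltnS leq_eqVlt.
have [->|ij] := eqVneq i j; first by rewrite /= eqxx ltnn /=; lra.
rewrite -val_eqE /= in ij; rewrite (negbTE ij) /=.
by case: ifP => _; lra.
Qed.

Context (dF : forall i x, differentiable (F i) x)
        (DE : forall x, D x = \sum_i dx i (F i) x).

Lemma differentiable_expansion (f : 'rV[R]_d -> R) x (e : R) : differentiable f x -> 0 < e ->
  exists2 r, 0 < r & forall v : 'rV[R]_d, `|v| <= r ->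
    `|f (x + v) - f x - 'd f x v| <= e * `|v|.
Proof.
move=> df e0.
have /diff_locallyP[_ /eqaddoP/(_ _ e0)] := df.
move=> /nbhs_ballP[r /= r0 Hr]; exists (r / 2); first lra.
move=> v vr; have := Hr v; rewrite -ball_normE /= sub0r normrN => /(_ _)/=.
rewrite !fctE /= [v + x]addrC opprD addrA; apply; lra.
Qed.

(** The affine part of [F i] at [x] contributes exactly the partial derivative, and the remainder on
    two opposite faces is a small multiple of [s], divided by the side [s]. Equal sides matter here:
    the remainder is controlled by the diameter of the box. The cube only has to contain [x]. *)
Lemma boxdefect_near x (e : R) : 0 < e -> exists2 r, 0 < r &
  forall a (s : R), 0 < s -> s <= r -> (forall i, a 0 i <= x 0 i <= a 0 i + s) ->
  `|boxdefect a (const_mx s)| <= e.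
Proof.
(* Each of the [d] flux quotients costs [2 * e1], one [e1] per face, and the continuity of [D] costs
   one more. *)
move=> e0; pose e1 := e / (d%:R * 2 + 1).
have d0 : 0 <= d%:R :> R by [].
have e10 : 0 < e1 by apply: divr_gt0 => //; lra.
have /choice[r Hr] i : exists r, 0 < r /\ forall v : 'rV[R]_d, `|v| <= r ->
    `|F i (x + v) - F i x - 'd (F i) x v| <= e1 * `|v|.
  by have [r r0 Hr] := differentiable_expansion (dF i x) e10; exists r.
have [rD rD0 HD] : exists2 r, 0 < r & forall y : 'rV[R]_d, `|y - x| <= r -> `|D y - D x| <= e1.
  have /cvgr_dist_le/(_ _ e10)/nbhs_ballP[r' /= r'0 Hr'] := @cD x.
  exists (r' / 2); first lra.
  move=> y yx; rewrite distrC; apply: Hr'; rewrite -ball_normE/= distrC; lra.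
pose r1 := \big[Num.min/rD]_i r i.
have r10 : 0 < r1 by apply: lt_bigmin => // i _; have [] := Hr i.
exists r1 => // a s s0 sr ax.
rewrite -[leRHS]mulr1 -[X in _ * X](expr1n _ d) -[X in _ * X ^+ _](subr0 1).
apply: boxI_norm_le => //; first exact: continuous_boxdefect_integrand.
move=> u uI.
have dist (y : 'rV[R]_d) : (forall i, a 0 i <= y 0 i <= a 0 i + s) -> `|y - x| <= s.
  move=> ay; rewrite (mx_normrE (y - x) : `|y - x| = _); apply: bigmax_le => [|[i j] _ /=]; first exact: ltW.
  by rewrite (ord1 i) !mxE ler_norml; have := ax j; have := ay j; lra.
have boxin (v : 'rV[R]_d) : inbox 0 1 v -> forall i, a 0 i <= boxpt a (const_mx s) v 0 i <= a 0 i + s.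
  by move=> vI i; rewrite !mxE; have := vI i; nra.
have fluxi i : `|(const_mx s : 'rV[R]_d) 0 i |^-1 = s^-1 by rewrite mxE gtr0_norm.
have Fi i : `|s^-1 * (F i (boxpt a (const_mx s) (vset u i 1)) -
     F i (boxpt a (const_mx s) (vset u i 0))) - dx i (F i) x| <= 2 * e1.
  set y1 := boxpt _ _ (vset u i 1); set y0 := boxpt _ _ (vset u i 0).
  have vI c : 0 <= c <= 1 -> inbox 0 1 (vset u i c).
    by move=> c01 k; rewrite mxE; case: eqP.
  have y1x : `|y1 - x| <= s by apply/dist/boxin/vI; lra.
  have y0x : `|y0 - x| <= s by apply/dist/boxin/vI; lra.
  have sri : s <= r i by apply: (le_trans sr); exact: bigmin_le.
  have [_ Hi] := Hr i.
  have := Hi _ (le_trans y1x sri); have := Hi _ (le_trans y0x sri).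
  rewrite ![x + _]addrC !subrK => H0 H1.
  have dE : 'd (F i) x (y1 - x) - 'd (F i) x (y0 - x) = s * dx i (F i) x.
    rewrite -linearB /dx deriveE; last exact: dF.
    rewrite -[_ * _]/(s *: _) -linearZ; congr ('d _ _ _).
    apply/rowP => k; rewrite !mxE eqxx /=; case: eqP => _ /=; ring.
  have E : s^-1 * (F i y1 - F i y0) - dx i (F i) x =
     s^-1 * ((F i y1 - F i x - 'd (F i) x (y1 - x)) - (F i y0 - F i x - 'd (F i) x (y0 - x))).
    rewrite (_ : _ - _ - _ - _ = F i y1 - F i y0 - s * dx i (F i) x); last by rewrite -dE; ring.
    by field; rewrite gt_eqF.
  rewrite E normrM gtr0_norm ?invr_gt0// ler_pdivrMl//.
  apply: (le_trans (ler_normB _ _)).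
  have h0 := le_trans H0 (ler_wpM2l (ltW e10) y0x).
  have h1 := le_trans H1 (ler_wpM2l (ltW e10) y1x).
  lra.
have DD : `|D (boxpt a (const_mx s) u) - D x| <= e1.
  apply: HD; apply: (@le_trans _ _ s); first exact/dist/boxin.
  by apply: (le_trans sr); exact: bigmin_le_id.
rewrite (_ : _ - _ = (boxflux a (const_mx s) u - D x) - (D (boxpt a (const_mx s) u) - D x)); last by ring.
apply: (le_trans (ler_normB _ _)).
have -> : e = d%:R * (2 * e1) + e1 by rewrite /e1; field; rewrite gt_eqF//; lra.
apply: lerD => //.
rewrite DE /boxflux -sumrB; apply: (le_trans (ler_norm_sum _ _ _)).
rewrite -[X in _ <= X%:R * _](card_ord d) mulr_natl -sumr_const.
by apply: ler_sum => i _; rewrite mxE.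
Qed.

(** Goursat: a nonzero defect would survive, above a fixed threshold, in nested cubes shrinking to a
    point, against [boxdefect_near] at that point. *)
Theorem boxdefect_eq0 a (s : R) : 0 < s -> boxdefect a (const_mx s) = 0.
Proof.
move=> s0; apply/eqP/negPn/negP; rewrite -normr_gt0 => E0.
pose e := `|boxdefect a (const_mx s)| / 2.
have e0 : 0 < e by rewrite /e; lra.
pose sz n : R := s / 2 ^+ n.
have sz0 n : 0 < sz n by apply: divr_gt0 => //; exact: exprn_gt0.
have szS n : sz n.+1 = sz n / 2 by rewrite /sz exprSr invfM mulrA.
pose T := {p : nat * 'rV[R]_d | e < `|boxdefect p.2 (const_mx (sz p.1))|}.
(* The badness of [b] is placed under the existential so that [choice] yields a total successor
   function. *)
have step n (b : 'rV[R]_d) : exists b', e < `|boxdefect b (const_mx (sz n))| ->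
   e < `|boxdefect b' (const_mx (sz n.+1))| /\
    forall i, b 0 i <= b' 0 i <= b 0 i + sz n.+1.
  have [h|h] := pselect (e < `|boxdefect b (const_mx (sz n))|); last by exists b.
  by have [b' Hb'] := boxdefect_child (sz0 n) h; exists b' => _; rewrite szS.
have [nxt Hnxt] := choice (fun p : nat * 'rV[R]_d => step p.1 p.2).
pose b := fix b n := if n is n'.+1 then nxt (n', b n') else a.
have bad n : e < `|boxdefect (b n) (const_mx (sz n))|.
  elim: n => [|n IH] /=; last by have [] := Hnxt (n, b n) IH.
  by rewrite /sz divr1 /e; lra.
have bS n i : b n 0 i <= b n.+1 0 i <= b n 0 i + sz n.+1.
  by have [_] := Hnxt (n, b n) (bad n); apply.
have bnm n m i : (n <= m)%N -> b n 0 i <= b m 0 i /\ b m 0 i + sz m <= b n 0 i + sz n.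
  elim: m => [|m IH]; first by rewrite leqn0 => /eqP ->.
  rewrite leq_eqVlt => /predU1P[->//|]; rewrite ltnS => /IH[h1 h2].
  have := bS m i; have := szS m; lra.
have bub i n m : b n 0 i <= b m 0 i + sz m.
  have := sz0 m; have := sz0 n.
  by case/orP: (leq_total n m) => /(bnm _ _ i)[]; lra.
(* The point common to all the nested cubes. *)
pose x : 'rV[R]_d := \row_i sup (range (fun n => b n 0 i)).
have bx n i : b n 0 i <= x 0 i <= b n 0 i + sz n.
  have ub : has_ubound (range (fun n => b n 0 i)).
    by exists (b 0 0 i + sz 0) => _ [m _ <-]; exact: bub.
  rewrite mxE; apply/andP; split; first by apply: ub_le_sup => //; exists n.
  by apply: ge_sup; [exists (b 0 0 i); exists 0|move=> _ [m _ <-]; exact: bub].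
have [r r0 Hr] := boxdefect_near x e0.
have [n nr] : exists n, sz n <= r.
  have : sz n @[n --> \oo] --> 0.
    rewrite -(mulr0 s); apply: cvgM; first exact: cvg_cst.
    under eq_fun do rewrite -exprVn.
    by apply: cvg_expr; rewrite ger0_norm; lra.
  move=> /cvgr0_norm_le/(_ _ r0)[N _ /(_ N (leqnn N))] h; exists N.
  by rewrite (le_trans (ler_norm _)).
have := Hr (b n) (sz n) (sz0 n) nr (bx n); rewrite leNgt bad //.
Qed.
End Divergence.

(** * Comparison with the integral over the whole space *)

Section IteratedIntegral.
Context {R : realType}.
Local Notation leb := (@lebesgue_measure R).

(** The integral of a nonnegative function is a supremum over simple functions below it, hence
    monotone without measurability. The inner integrals of an arbitrary score call for this
    generality. *)
Lemma ge0_le_integral_nonmeasurable (f g : R -> \bar R) :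
  (forall t, 0 <= f t)%E -> (forall t, f t <= g t)%E ->
  (\int[leb]_(t in setT) f t <= \int[leb]_(t in setT) g t)%E.
Proof.
move=> f0 fg; rewrite !ge0_integralE//; last by move=> t _; exact: le_trans (fg t).
apply: ereal_sup_le => _ [h /= hf <-]; exists h => //= t.
by apply: (le_trans (hf t)); rewrite !patch_setT.
Qed.

Lemma segI_EFin a b (f : R -> R) : continuous f ->
  (segI a b f)%:E = (\int[leb]_(t in setT) ((EFin \o f) \_ `[a, b]) t)%E.
Proof.
move=> cf; rewrite -integral_mkcond /segI /Rintegral fineK//.
by apply: integrable_fin_num => //; exact: segI_integrable.
Qed.

Lemma iint_ge0 d (g : 'rV[R]_d -> \bar R) : (forall x, 0 <= g x)%E -> (0 <= iint g)%E.
Proof.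
elim: d g => [|d IH] g g0 /=; first exact: g0.
by apply: integral_ge0 => t _; apply: IH => y; exact: g0.
Qed.

Lemma boxI_le_iint a b d (g : 'rV[R]_d -> R) : a <= b -> continuous g ->
  (forall x, 0 <= g x) -> ((boxI a b g)%:E <= iint (fun x => (g x)%:E))%E.
Proof.
move=> ab; elim: d g => [|d IH] g cg g0 //=.
rewrite segI_EFin; last exact: continuous_boxI_slice.
apply: ge0_le_integral_nonmeasurable => t.
  rewrite patchE; case: ifP => // _; rewrite lee_fin.
  exact: boxI_ge0.
rewrite patchE; case: ifP => _; last by apply: iint_ge0 => y; rewrite lee_fin.
by apply: IH => //; exact: continuous_slice.
Qed.

(** * Dominated convergence for iterated integrals *)

Section Dominated.
Context (k : R -> R) (ck : continuous k) (k0 : forall t, 0 <= k t)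
        (ik : leb.-integrable setT (EFin \o k)).

(** A product majorant is stable under slicing: fixing the first coordinate at [t] only changes the
    constant [C] into [C * k t]. *)
Definition prodk d (x : 'rV[R]_d) := \prod_i k (x 0 i).

Lemma prodk_vcons d t (y : 'rV[R]_d) : prodk (vcons t y) = k t * prodk y.
Proof.
rewrite /prodk big_ord_recl vcons0; congr (_ * _).
by apply: eq_bigr => i _; rewrite vconsS.
Qed.

Lemma boxI_dominated a b d C K (g : 'rV[R]_d -> R) : a <= b -> 0 <= C ->
  segI a b k <= K -> continuous g -> (forall x, `|g x| <= C * prodk x) ->
  `|boxI a b g| <= C * K ^+ d.
Proof.
move=> ab + kK; have K0 : 0 <= K by apply: le_trans kK; exact: segI_ge0.
elim: d C g => [|d IH] C g C0 cg gC /=.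
  by apply: (le_trans (gC 0)); rewrite /prodk big_ord0.
have cG := continuous_boxI_slice ab cg.
have cM : continuous (fun t => C * K ^+ d * k t).
  by apply: continuous_mul => //; exact: continuous_cst.
have bnd t : `|boxI a b (fun y => g (vcons t y))| <= C * K ^+ d * k t.
  rewrite mulrAC; apply: IH; [exact: mulr_ge0|exact: continuous_slice|].
  by move=> y; rewrite -mulrA -prodk_vcons.
apply: (@le_trans _ _ (C * K ^+ d * segI a b k)).
  rewrite -segIZ// ler_norml -mulN1r -segIZ//; apply/andP; split; apply: le_segI => //.
  - by apply: continuous_mul => //; exact: continuous_cst.
  - by move=> t _; have := bnd t; rewrite ler_norml mulN1r => /andP[].
  - by move=> t _; have := bnd t; rewrite ler_norml => /andP[].
rewrite exprSr mulrA ler_wpM2l// mulr_ge0// exprn_ge0//.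
Qed.

Lemma segI_le_integral a b : segI a b k <= fine (\int[leb]_(t in setT) (k t)%:E)%E.
Proof.
rewrite -lee_fin [leRHS]fineK; last exact: (@integrable_fin_num _ _ _ leb setT measurableT (EFin \o k) ik).
rewrite segI_EFin//; apply: ge0_le_integral_nonmeasurable => t;
  by rewrite patchE; case: ifP; rewrite ?lee_fin.
Qed.

Lemma iint_dominated d C (g : 'rV[R]_d -> R) : 0 <= C -> continuous g ->
  (forall x, `|g x| <= C * prodk x) ->
  exists2 l, iint (fun x => (g x)%:E) = l%:E &
    boxI (- N%:R) N%:R g @[N --> \oo] --> l.
Proof.
elim: d C g => [|d IH] C g C0 cg gC /=.
  by exists (g 0) => //; exact: cvg_cst.
pose K := fine (\int[leb]_(t in setT) (k t)%:E)%E.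
have sl t : exists l, iint (fun y => (g (vcons t y))%:E) = l%:E /\
    boxI (- N%:R) N%:R (fun y => g (vcons t y)) @[N --> \oo] --> l.
  have [||y|l l1 l2] := IH (C * k t) (fun y => g (vcons t y)).
  - exact: mulr_ge0.
  - exact: continuous_slice.
  - by rewrite -mulrA -prodk_vcons.
  - by exists l.
have [l /all_and2[l1 l2]] := choice sl.
(* Integral over the slice of the cube at [t], extended by 0 outside [[-N, N]]; the majorant below
   is [C * K ^+ d * k]. *)
pose f (N : nat) (t : R) : \bar R := ((EFin \o (fun t => boxI (- N%:R) N%:R (fun y => g (vcons t y))))
               \_ (`[- N%:R, N%:R]%classic : set R)) t.
have NN (N : nat) : - N%:R <= N%:R :> R by rewrite lerNl; have : 0 <= N%:R :> R by []; lra.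
have cG (N : nat) := continuous_boxI_slice (NN N) cg.
have mf N : measurable_fun [set: measurableTypeR R] (f N).
  apply: (measurable_restrictT _ _).1; first exact: measurable_itv.
  apply/measurable_EFinP.
  exact: measurable_funS (continuous_measurable_fun (cG N)).
have ff t : setT t -> f^~ t @ \oo --> (l t)%:E.
  move=> _; apply: cvg_EFin.
    by apply: nearW => N; rewrite /f patchE; case: ifP.
  apply: cvg_trans (l2 t); apply: near_eq_cvg.
  exists (Num.truncn `|t|).+1 => // N /= HN.
  rewrite /f patchE ifT// inE/= in_itv/= -ler_norml.
  apply: (@le_trans _ _ (Num.truncn `|t|).+1%:R); first exact/ltW/truncnS_gt.
  by rewrite ler_nat.
have K0 : 0 <= K.
  by apply: fine_ge0; apply: integral_ge0 => t _; rewrite lee_fin.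
pose G t := (C * K ^+ d * k t)%:E.
have iG : leb.-integrable setT G.
  by rewrite /G; under eq_fun do rewrite EFinM; exact: integrableZl.
have fG N t : setT t -> (`|f N t| <= G t)%E.
  move=> _; rewrite /f patchE; case: ifP => _; last first.
    by rewrite abse0 /G lee_fin !mulr_ge0// exprn_ge0.
  rewrite /G lee_fin mulrAC; apply: boxI_dominated => //.
  - exact: mulr_ge0.
  - exact: segI_le_integral.
  - exact: continuous_slice.
  - by move=> y; rewrite -mulrA -prodk_vcons.
(* The inner iterated integral is measurable as a pointwise limit of the slice integrals. *)
have ml : measurable_fun [set: measurableTypeR R] (EFin \o l) by exact: (emeasurable_fun_cvg f _ mf ff).
have [il _ cl] := @dominated_convergence _ (measurableTypeR R) R leb setT measurableT
   f (fun t => (l t)%:E) G mf ml (aeW leb ff) iG (aeW leb (fun t n => @fG n t)).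
exists (fine (\int[leb]_(t in setT) (l t)%:E)%E).
  rewrite fineK; last exact: (@integrable_fin_num _ _ _ leb setT measurableT (EFin \o l) il).
  by apply: eq_integral => t _; exact: l1.
have cl' : fine (\int[leb]_(t in setT) f N t)%E @[N --> \oo] -->
    fine (\int[leb]_(t in setT) (l t)%:E)%E.
  apply: fine_cvg; rewrite fineK; first exact: cl.
  exact: (@integrable_fin_num _ _ _ leb setT measurableT (EFin \o l) il).
apply: cvg_trans cl'; apply: near_eq_cvg; apply: nearW => N /=.
by rewrite -segI_EFin.
Qed.
End Dominated.
End IteratedIntegral.

(** * Partial derivatives *)

Section PartialDerivatives.
Context {R : realType} {d : nat}.
Implicit Types (f g : 'rV[R]_d -> R) (df dg : 'I_d -> 'rV[R]_d -> R).

(** Differentiability together with a formula for the partial derivatives. Nothing is asked of [df]: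
    the second derivatives of a score are known only pointwise. *)
Definition hasdx f df := forall x, differentiable f x /\ forall i, dx i f x = df i x.

Lemma hasdx_differentiable f : (forall x, differentiable f x) -> hasdx f (fun i => dx i f).
Proof. by move=> df x; split. Qed.

Lemma eq_hasdx f g df dg : hasdx f df -> f =1 g -> (forall i x, df i x = dg i x) -> hasdx g dg.
Proof.
move=> hf /funext <- E x; have [h1 h2] := hf x.
by split => // i; rewrite h2.
Qed.

Lemma hasdx_continuous f df : hasdx f df -> continuous f.
Proof. by move=> hf x; apply: differentiable_continuous; have [] := hf x. Qed.

Lemma hasdx_cst k : hasdx (fun=> k) (fun _ _ => 0).
Proof.
move=> x; split => [|i]; first exact: differentiable_cst.
by rewrite /dx deriveE ?diff_cst//; exact: differentiable_cst.
Qed.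

Lemma hasdx_coord j : hasdx (fun x => x 0 j) (fun i _ => (j == i)%:R).
Proof.
move=> x; split => [|i]; first exact: differentiable_coord.
rewrite /dx /derive; apply/cvg_lim => //.
apply: cvg_near_cst; exists 1 => //= h _ h0.
rewrite !mxE eqxx /= addrK; case: eqP => _; rewrite ?mulr0 ?scaler0//.
by rewrite mulr1 [LHS]mulVf.
Qed.

Lemma hasdxD f g df dg : hasdx f df -> hasdx g dg ->
  hasdx (fun x => f x + g x) (fun i x => df i x + dg i x).
Proof.
move=> hf hg x; have [f1 f2] := hf x; have [g1 g2] := hg x.
split => [|i]; first exact: differentiableD.
rewrite /dx (_ : (fun x => _) = f + g)// deriveD; [|exact: diff_derivable..].
by rewrite -f2 -g2.
Qed.

Lemma hasdxM f g df dg : hasdx f df -> hasdx g dg ->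
  hasdx (fun x => f x * g x) (fun i x => df i x * g x + f x * dg i x).
Proof.
move=> hf hg x; have [f1 f2] := hf x; have [g1 g2] := hg x.
split => [|i]; first exact: differentiableM.
rewrite /dx (_ : (fun x => _) = f * g)// deriveM; [|exact: diff_derivable..].
by rewrite -f2 -g2 /dx /GRing.scale/=; ring.
Qed.

Lemma hasdxZ k f df : hasdx f df -> hasdx (fun x => k * f x) (fun i x => k * df i x).
Proof.
move=> hf; apply: (eq_hasdx (hasdxM (hasdx_cst k) hf)) => // i x.
by rewrite mul0r add0r.
Qed.

Lemma hasdxN f df : hasdx f df -> hasdx (fun x => - f x) (fun i x => - df i x).
Proof.
move=> hf; apply: (eq_hasdx (hasdxZ (-1) hf)) => [x|i x]; exact: mulN1r.
Qed.

Lemma hasdx_sum (I : Type) (r : seq I) (F : I -> 'rV[R]_d -> R) dF :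
  (forall k, hasdx (F k) (dF k)) ->
  hasdx (fun x => \sum_(k <- r) F k x) (fun i x => \sum_(k <- r) dF k i x).
Proof.
move=> hF; elim: r => [|k r IH].
  by apply: (eq_hasdx (hasdx_cst 0)) => [x|i x] /=; rewrite big_nil.
by apply: (eq_hasdx (hasdxD (hF k) IH)) => [x|i x] /=; rewrite big_cons.
Qed.

Lemma hasdx_comp (u u' : R -> R) f df : (forall t : R, is_derive t (1 : R) u (u' t)) ->
  hasdx f df -> hasdx (fun x => u (f x)) (fun i x => u' (f x) * df i x).
Proof.
move=> hu hf x; have [f1 f2] := hf x.
have du : differentiable u (f x) by apply/derivable1_diffP; exact: ex_derive.
have dc : differentiable (u \o f) x by exact: differentiable_comp.
split => // i.
have e : 'd f x (delta_mx 0 i) = df i x by rewrite -f2 /dx deriveE.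
rewrite /dx deriveE// diff_comp//= e diff1E//.
by rewrite derive1E derive_val /GRing.scale/= mulrC.
Qed.

Lemma differential_dx f x v : differentiable f x ->
  'd f x v = \sum_i v 0 i * dx i f x.
Proof.
move=> df; rewrite {1}(row_sum_delta v) linear_sum; apply: eq_bigr => i _.
by rewrite linearZ /dx deriveE.
Qed.

Lemma dx_eq0_cst f x : (forall y, differentiable f y) ->
  (forall i y, dx i f y = 0) -> f x = f 0.
Proof.
move=> df f0.
have h t : is_derive (t : R) 1 (fun t : R => f (t *: x)) 0.
  have dl : is_diff t (fun t : R => t *: x) ( *:%R ^~ x) by exact: is_diff_scalel.
  have dc : differentiable (fun t : R => f (t *: x)) t.
    by apply: (@differentiable_comp _ _ _ _ (fun t : R => t *: x) f).
  apply: DeriveDef; first exact: diff_derivable.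
  rewrite deriveE// (@diff_comp _ _ _ _ (fun t : R => t *: x) f)//=.
  by rewrite differential_dx// big1// => i _; rewrite f0 mulr0.
have := is_derive_0_is_cst 1 0 h.
by rewrite scale1r scale0r.
Qed.

End PartialDerivatives.

(** * Flux estimate on a centred cube *)

Section BoxDivergence.
Context {R : realType} {d : nat}.

(** The right-hand side is [M] times the total area of the [2 d] faces, each of area (2 r)^(d - 1).
    Continuity is asked of the divergence as a whole, not of its terms. *)
Lemma boxI_divergence_le (F : 'I_d -> 'rV[R]_d -> R) (dF : 'I_d -> 'I_d -> 'rV[R]_d -> R) (r M : R) :
  0 < r -> (forall i, hasdx (F i) (dF i)) -> continuous (fun x => \sum_i dF i i x) ->
  (forall i x, inbox (- r) r x -> `|x 0 i| = r -> `|F i x| <= M) ->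
  `|boxI (- r) r (fun x => \sum_i dF i i x)| <= (r *+ 2) ^+ d * (d%:R * M / r).
Proof.
move=> r0 hF cD FM.
have rr : - r < r by lra.
rewrite (boxI_affine rr cD) (_ : r - - r = r *+ 2); last by rewrite opprK mulr2n.
rewrite normrM ger0_norm; last by rewrite exprn_ge0// mulrn_wge0// ltW.
apply: ler_wpM2l; first by rewrite exprn_ge0// mulrn_wge0// ltW.
have cF i : continuous (F i) := hasdx_continuous (hF i).
have DE x : \sum_i dF i i x = \sum_i dx i (F i) x.
  by apply: eq_bigr => i _; have [_ ->] := hF i x.
have r20 : 0 < r *+ 2 by rewrite pmulrn_lgt0.
have E0 := boxdefect_eq0 cF cD (fun i x => (hF i x).1) DE (const_mx (- r)) r20.
have cflux := @continuous_boxflux R d F cF (const_mx (- r)) (const_mx (r *+ 2)).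
have cDp : continuous (fun u => \sum_i dF i i (boxpt (const_mx (- r)) (const_mx (r *+ 2)) u)).
  move=> u; apply: (@continuous_comp _ _ _ (boxpt _ _) (fun x => \sum_i dF i i x)); last exact: cD.
  by apply: (continuous_boxpt (f := id)) => v; exact: cvg_id.
have := etrans (esym (boxID ler01 cflux (continuous_opp cDp))) E0.
under [X in _ + X]eq_boxI do rewrite -mulN1r.
rewrite boxIZ// mulN1r => /eqP; rewrite subr_eq0 => /eqP fluxE.
rewrite (_ : boxI 0 1 _ = boxI 0 1 (boxflux F (const_mx (- r)) (const_mx (r *+ 2)))); last first.
  rewrite fluxE; apply: eq_boxI => u _; apply: eq_bigr => i _; congr (dF i i _).
  by apply/rowP => k; rewrite !mxE.
rewrite -[leRHS]mulr1 -[X in _ * X](expr1n _ d) -[X in _ * X ^+ _](subr0 1).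
apply: boxI_norm_le => // u uI.
apply: (le_trans (ler_norm_sum _ _ _)).
have -> : d%:R * M / r = \sum_(i < d) (M / r) by rewrite sumr_const card_ord -mulrA mulr_natl.
apply: ler_sum => i _; rewrite mxE normrM gtr0_norm ?invr_gt0//.
have inb c : 0 <= c <= 1 -> inbox (- r) r (boxpt (const_mx (- r)) (const_mx (r *+ 2)) (vset u i c)).
  by move=> c01 k; rewrite !mxE mulr2n; have := uI k; case: eqP => _; nra.
have b1 : `|F i (boxpt (const_mx (- r)) (const_mx (r *+ 2)) (vset u i 1))| <= M.
  apply: FM; first by apply: inb; lra.
  by rewrite !mxE eqxx mulr1 mulr2n addrA addNr add0r gtr0_norm.
have b0 : `|F i (boxpt (const_mx (- r)) (const_mx (r *+ 2)) (vset u i 0))| <= M.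
  apply: FM; first by apply: inb; lra.
  by rewrite !mxE eqxx mulr0 addr0 normrN gtr0_norm.
rewrite ler_pdivrMl//; apply: (le_trans (ler_normB _ _)).
rewrite (_ : r *+ 2 * (M / r) = M + M); first exact: lerD.
by rewrite mulr2n; field; rewrite gt_eqF.
Qed.

End BoxDivergence.

(** * Energy estimate *)

Section Energy.
Context {R : realType} {d : nat}.

Lemma boxI_sum a b (I : Type) (s : seq I) (F : I -> 'rV[R]_d -> R) : a <= b ->
  (forall k, continuous (F k)) ->
  boxI a b (fun x => \sum_(k <- s) F k x) = \sum_(k <- s) boxI a b (F k).
Proof.
move=> ab cF; elim: s => [|k s IH].
  rewrite big_nil; under eq_boxI do rewrite big_nil.
  by rewrite boxI_cst// mul0r.
rewrite big_cons -IH -boxID//; last exact: continuous_sum.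
by apply: eq_boxI => x _; rewrite big_cons.
Qed.

(** The function is the product over [k] in [s] of 1 - (x_k / r)^2. On the cube each factor has
    derivative at most 2 / r; on the half cube it is at least 1 - 1/4. Induction on a list of
    directions replaces the product rule for many factors. *)
Lemma cutoff (s : seq 'I_d) (r : R) : 0 < r ->
  exists phi (dphi : 'I_d -> 'rV[R]_d -> R),
  [/\ hasdx phi dphi, forall i, continuous (dphi i),
      forall x, inbox (- r) r x -> 0 <= phi x <= 1 /\
        forall i, `|dphi i x| <= (size s)%:R * 2 / r,
      forall (x : 'rV[R]_d) i, i \in s -> `|x 0 i| = r -> phi x = 0
    & forall x, inbox (- (r / 2)) (r / 2) x -> (3 / 4) ^+ size s <= phi x].
Proof.
move=> r0; elim: s => [|k s [P [dP [h1 h2 h3 h4 h5]]]].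
  exists (fun=> 1), (fun _ _ => 0); split => //.
  - exact: hasdx_cst.
  - by move=> i; exact: continuous_cst.
  - by move=> x _; split => [|i]; [lra|rewrite normr0 mul0r mul0r].
pose q (x : 'rV[R]_d) := 1 + - r ^- 2 * (x 0 k * x 0 k).
pose dq i (x : 'rV[R]_d) := - (2 * r ^- 2) * x 0 k * (k == i)%:R.
have hq : hasdx q dq.
  apply: (eq_hasdx (hasdxD (hasdx_cst 1)
    (hasdxZ (- r ^- 2) (hasdxM (hasdx_coord k) (hasdx_coord k))))) => // i x.
  by rewrite /dq; ring.
have qE (x : 'rV[R]_d) : q x = 1 - (x 0 k / r) ^+ 2.
  by rewrite /q expr_div_n expr2; ring.
exists (fun x => q x * P x), (fun i x => dq i x * P x + q x * dP i x); split.
- exact: hasdxM.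
- move=> i; apply: continuous_add; apply: continuous_mul => //.
  + apply: continuous_mul; last exact: continuous_cst.
    by apply: continuous_mul; [exact: continuous_cst|exact: coord_continuous].
  + exact: hasdx_continuous h1.
  + exact: hasdx_continuous hq.
- move=> x xI; have [/andP[P0 P1] dPb] := h3 x xI.
  have /andP[x1 x2] : -1 <= x 0 k / r <= 1.
    by rewrite ler_pdivlMr// ler_pdivrMr// mulN1r mul1r.
  have /andP[q0 q1] : 0 <= q x <= 1 by rewrite qE; apply/andP; split; nra.
  split=> [|i] /=.
    by apply/andP; split; [exact: mulr_ge0|rewrite mulr_ile1].
  have dqb : `|dq i x| <= 2 / r.
    rewrite /dq (_ : _ * _ * _ = (x 0 k / r) * (- (k == i)%:R) * (2 / r)); last first.
      by field; rewrite gt_eqF.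
    rewrite normrM [X in _ * X]gtr0_norm ?divr_gt0//.
    apply: ler_piMl; [by apply: divr_ge0 => //; exact: ltW|rewrite normrM; apply: mulr_ile1 => //].
      by rewrite ler_norml x1 x2.
    by rewrite normrN; case: eqP; rewrite ?normr1 ?normr0.
  apply: (le_trans (ler_normD _ _)).
  have -> : (size (k :: s))%:R * 2 / r = 2 / r + (size s)%:R * 2 / r :> R.
    by rewrite /= -addn1 natrD; ring.
  apply: lerD; rewrite normrM.
    by rewrite -[leRHS]mulr1 ler_pM// ger0_norm.
  by rewrite -[leRHS]mul1r ler_pM// ger0_norm.
- move=> x i; rewrite inE => /predU1P[->|/h4 h] xr; last by rewrite h// mulr0.
  rewrite qE -[_ ^+ 2]ger0_norm ?sqr_ge0// normrX normrM xr normfV gtr0_norm//.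
  by rewrite divff ?gt_eqF// expr1n subrr mul0r.
- move=> x xI; rewrite exprS; apply: ler_pM; [lra|by apply: exprn_ge0; lra| |exact: h5].
  have /andP[x1 x2] : - 2^-1 <= x 0 k / r <= 2^-1.
    by rewrite ler_pdivlMr// ler_pdivrMr//; have := xI k; lra.
  by rewrite qE; nra.
Qed.

Context (p : 'rV[R]_d -> R) (dp : 'I_d -> 'rV[R]_d -> R)
  (h : 'rV[R]_d -> R) (dh : 'I_d -> 'rV[R]_d -> R)
  (ddh : 'I_d -> 'I_d -> 'rV[R]_d -> R).
Context (p0 : forall x, 0 < p x) (hp : hasdx p dp) (hh : hasdx h dh)
  (hdh : forall i, hasdx (dh i) (ddh i))
  (pde : forall x, \sum_i (dp i x * dh i x + p x * ddh i i x) = 0).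

Let cp : continuous p := hasdx_continuous hp.
Let ch : continuous h := hasdx_continuous hh.
Let cdh i : continuous (dh i) := hasdx_continuous (hdh i).

Let grad2 x := p x * \sum_i dh i x ^+ 2.

Let grad2_ge0 x : 0 <= grad2 x.
Proof. by apply: mulr_ge0; [exact: ltW|apply: sumr_ge0 => i _; exact: sqr_ge0]. Qed.

Let continuous_sqr (f : 'rV[R]_d -> R) : continuous f -> continuous (fun x => f x ^+ 2).
Proof. by move=> cf; under eq_fun do rewrite expr2; exact: continuous_mul. Qed.

Let continuous_grad2 : continuous grad2.
Proof. by apply: continuous_mul => //; apply: continuous_sum => i; exact: continuous_sqr. Qed.

(* Testing the equation against phi^2 h, with phi a cutoff for [-r, r]^d. *)
Lemma energy_le (r C : R) : 0 < r ->
  boxI (- r) r (fun x => p x * h x ^+ 2) <= C ->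
  (forall i, boxI (- r) r (fun x => p x * dh i x ^+ 2) <= C) ->
  (3 / 4) ^+ d ^+ 2 * boxI (- (r / 2)) (r / 2) grad2 <= 4 * d%:R ^+ 2 * C / r.
Proof.
move=> r0 hC dhC.
have [phi [dphi [f1 f2 f3 f4 f5]]] := cutoff (enum 'I_d) r0.
rewrite size_enum_ord in f3 f5.
have cphi := hasdx_continuous f1.
have rr : - r <= r by lra.
pose F i x := (phi x * phi x * h x) * (p x * dh i x).
pose D x := \sum_i (2 * phi x * dphi i x * h x + phi x ^+ 2 * dh i x) * (p x * dh i x).
pose dF i j x := ((dphi j x * phi x + phi x * dphi j x) * h x + phi x * phi x * dh j x) * (p x * dh i x)
  + (phi x * phi x * h x) * (dp j x * dh i x + p x * ddh i j x).
have hF i : hasdx (F i) (dF i).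
  by apply: hasdxM; [apply: hasdxM => //; exact: hasdxM|exact: hasdxM].
(* Second derivatives of [h] occur only in the combination that the equation annihilates, so the
   divergence is continuous although its summands may not be. *)
have DE : (fun x => \sum_i dF i i x) = D.
  apply/funext => x; rewrite /dF big_split/= -mulr_sumr pde mulr0 addr0.
  by apply: eq_bigr => i _; ring.
have cterm i : continuous (fun x => 2 * phi x * dphi i x * h x).
  do 2!apply: continuous_mul => //; apply: continuous_mul => //; exact: continuous_cst.
have cD : continuous D.
  apply: continuous_sum => i; apply: continuous_mul; last exact: continuous_mul.
  by apply: continuous_add => //; apply: continuous_mul => //; exact: continuous_sqr.
have cDF : continuous (fun x => \sum_i dF i i x) by rewrite DE.
have := boxI_divergence_le (M := 0) r0 hF cDF.
rewrite DE mulr0 mul0r mulr0 => /(_ _)/le_trans/(_ (lexx 0)).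
have Fb i (x : 'rV[R]_d) : inbox (- r) r x -> `|x 0 i| = r -> `|F i x| <= 0.
  by move=> _ xr; rewrite /F (f4 x i)// ?mem_enum// !mul0r normr0.
move=> /(_ Fb); rewrite normr_le0 => /eqP D0.
pose G x := phi x ^+ 2 * grad2 x.
have cG : continuous G by apply: continuous_mul => //; exact: continuous_sqr.
pose k : R := 2 * d%:R / r.
have k0 : 0 <= k by apply: divr_ge0; [exact: mulr_ge0|exact: ltW].
pose E i x := k * (p x * h x ^+ 2 + p x * dh i x ^+ 2).
have cph : continuous (fun x => p x * h x ^+ 2).
  by apply: continuous_mul => //; exact: continuous_sqr.
have cpdh i : continuous (fun x => p x * dh i x ^+ 2).
  by apply: continuous_mul => //; exact: continuous_sqr.
have cE i : continuous (E i).
  by apply: continuous_mul; [exact: continuous_cst|exact: continuous_add].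
(* [G - D] is the cross term - 2 phi p h (grad phi . grad h). Each of its summands is at most [E i],
   by [2 |a b| <= a ^ 2 + b ^ 2] and [|phi * dphi i| <= k]. *)
have GDE x : inbox (- r) r x -> G x <= D x + \sum_i E i x.
  move=> xI; have [/andP[fx0 fx1] dfx] := f3 x xI.
  rewrite /G /grad2 mulrCA mulr_sumr mulr_sumr /D -big_split/=; apply: ler_sum => i _.
  rewrite /E.
  have px := p0 x; have /= dfi := dfx i.
  set a := h x; set b := dh i x; set c := phi x; set e := dphi i x.
  have eb : `|e| <= k by rewrite /k [2 * _]mulrC.
  have ce : `|c * e| <= k.
    by rewrite normrM ger0_norm// -[leRHS]mul1r ler_pM.
  have : - (2 * (c * e) * (a * b)) <= k * (a ^+ 2 + b ^+ 2).
    move: ce; rewrite ler_norml => /andP[ce1 ce2].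
    have := sqr_ge0 (a + b); have := sqr_ge0 (a - b); rewrite sqrrB sqrrD => s1 s2.
    have [ab|ab] := leP 0 (a * b); nra.
  move=> /(ler_wpM2l (ltW px)); nra.
have GI : boxI (- r) r G <= 4 * d%:R ^+ 2 * C / r.
  apply: (@le_trans _ _ (boxI (- r) r (fun x => D x + \sum_i E i x))).
    apply: le_boxI => //; apply: continuous_add => //; exact: continuous_sum.
  rewrite boxID//; last exact: continuous_sum.
  rewrite D0 add0r boxI_sum//.
  have -> : 4 * d%:R ^+ 2 * C / r = \sum_(i < d) k * (C + C).
    by rewrite sumr_const card_ord -[RHS]mulr_natr /k; field; rewrite gt_eqF.
  apply: ler_sum => i _; rewrite boxIZ//; last exact: continuous_add.
  by apply: ler_wpM2l => //; rewrite boxID// lerD.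
apply: le_trans GI.
apply: (@le_trans _ _ (boxI (- (r / 2)) (r / 2) G)).
  rewrite -boxIZ//; last lra.
  apply: le_boxI => //; first by lra.
    by apply: continuous_mul => //; exact: continuous_cst.
  move=> x xI; apply: ler_wpM2r; first exact: grad2_ge0.
  by rewrite lerXn2r// ?nnegrE ?exprn_ge0// ?(le_trans _ (f5 x xI)) ?exprn_ge0 ?f5//; lra.
apply: boxI_sub_le => //; try lra.
by move=> x; apply: mulr_ge0 => //; exact: sqr_ge0.
Qed.

Lemma energy_cst (C : R) :
  (forall r, 0 < r -> boxI (- r) r (fun x => p x * h x ^+ 2) <= C) ->
  (forall r i, 0 < r -> boxI (- r) r (fun x => p x * dh i x ^+ 2) <= C) ->
  forall x, h x = h 0.
Proof.
move=> hC dhC x; apply: dx_eq0_cst => [y|i y]; first by have [] := hh y.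
have [_ ->] := hh y.
have C0 : 0 <= C.
  by apply: le_trans (hC 1 ltr01); apply: boxI_ge0 => z _; rewrite mulr_ge0 ?sqr_ge0 ?ltW.
pose r0 : R := 1 + \sum_j `|y 0 j|.
have yr j : - r0 < y 0 j < r0.
  rewrite -ltr_norml /r0 (bigD1 j)//=.
  have : 0 <= \sum_(i0 < d | i0 != j) `|y 0 i0| by apply: sumr_ge0.
  by lra.
have r00 : 0 < r0.
  have : 0 <= \sum_j `|y 0 j| by apply: sumr_ge0.
  by rewrite /r0; lra.
pose A := (3 / 4) ^+ d ^+ 2 * boxI (- r0) r0 grad2.
have q0 : 0 < (3 / 4 : R) ^+ d ^+ 2 by rewrite !exprn_gt0//; lra.
have A0 : 0 <= A.
  by apply: mulr_ge0; [exact: ltW|exact: boxI_ge0].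
have Ale r : r0 <= r -> A <= 4 * d%:R ^+ 2 * C / (r *+ 2).
  move=> rr; have r2 : 0 < r *+ 2 by rewrite pmulrn_lgt0//; lra.
  apply: (le_trans _ (energy_le r2 (hC _ r2) (fun i => dhC _ i r2))).
  rewrite ler_pM2l//; apply: boxI_sub_le => //.
  - by rewrite lerN2 mulr2n; lra.
  - by lra.
  - by rewrite mulr2n; lra.
have A00 : A = 0.
  apply/eqP; rewrite eq_le A0 andbT leNgt; apply/negP => Apos.
  pose B := 4 * d%:R ^+ 2 * C.
  have B0 : 0 <= B by rewrite /B !mulr_ge0 ?sqr_ge0.
  have BA0 : 0 <= B / A by apply: divr_ge0 => //; exact: ltW.
  (* At this radius the energy bound would read [2 * (A * r0 + B) <= B]. *)
  have r1 : 0 < (r0 + B / A) *+ 2 by rewrite pmulrn_lgt0//; lra.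
  have := Ale (r0 + B / A) ltac:(lra).
  rewrite ler_pdivlMr// mulrnAr mulrDr [A * (B / A)]mulrC divfK ?gt_eqF// mulr2n.
  by rewrite -/B; have := mulr_gt0 Apos r00; lra.
have I0 : boxI (- r0) r0 grad2 = 0.
  by apply/eqP; move/eqP: A00; rewrite mulf_eq0 gt_eqF.
have := boxI_eq0 _ continuous_grad2 grad2_ge0 I0 yr.
move=> /(_ ltac:(lra))/eqP; rewrite mulf_eq0 gt_eqF//=.
rewrite psumr_eq0 => [|k _]; last exact: sqr_ge0.
by move=> /allP/(_ i (mem_index_enum i))/=; rewrite sqrf_eq0 => /eqP.
Qed.
End Energy.

(** The difference is controlled on each cube by (f - g)^2 <= 2 f^2 + 2 g^2, after each [iint] has
    been replaced by a uniform bound on cubes; [iint] itself is never split. *)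
Lemma div_grad_unique (R : realType) (d : nat) (p : 'rV[R]_d -> R) dp
    (S q rhs : 'rV[R]_d -> R) dS dq ddS ddq :
  (forall x, 0 < p x) -> hasdx p dp ->
  hasdx S dS -> (forall i, hasdx (dS i) (ddS i)) ->
  hasdx q dq -> (forall i, hasdx (dq i) (ddq i)) ->
  (forall x, \sum_i (dp i x * dS i x + p x * ddS i i x) = rhs x) ->
  (forall x, \sum_i (dp i x * dq i x + p x * ddq i i x) = rhs x) ->
  (iint (fun x => (S x ^+ 2 * p x)%:E) < +oo)%E ->
  (iint (fun x => (q x ^+ 2 * p x)%:E) < +oo)%E ->
  (forall i, iint (fun x => (dS i x ^+ 2 * p x)%:E) < +oo)%E ->
  (forall i, iint (fun x => (dq i x ^+ 2 * p x)%:E) < +oo)%E ->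
  forall x, S x - q x = S 0 - q 0.
Proof.
move=> pos hp hS hdS hq hdq pdeS pdeq S2 q2 dS2 dq2.
have cp := hasdx_continuous hp.
have hh := hasdxD hS (hasdxN hq).
have hdh i := hasdxD (hdS i) (hasdxN (hdq i)).
have pde x : \sum_i (dp i x * (dS i x - dq i x) + p x * (ddS i i x - ddq i i x)) = 0.
  transitivity (\sum_i (dp i x * dS i x + p x * ddS i i x) -
                \sum_i (dp i x * dq i x + p x * ddq i i x)).
    by rewrite -sumrB; apply: eq_bigr => i _; ring.
  by rewrite pdeS pdeq subrr.
have bound (f g : 'rV[R]_d -> R) : continuous f -> continuous g ->
    (iint (fun x => (f x ^+ 2 * p x)%:E) < +oo)%E ->
    (iint (fun x => (g x ^+ 2 * p x)%:E) < +oo)%E ->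
    exists C, forall r, 0 < r -> boxI (- r) r (fun x => p x * (f x - g x) ^+ 2) <= C.
  move=> cf cg f2 g2.
  have h1 (u : 'rV[R]_d -> R) : continuous u -> (iint (fun x => (u x ^+ 2 * p x)%:E) < +oo)%E ->
      continuous (fun x => u x ^+ 2 * p x) /\ forall r, 0 < r ->
      boxI (- r) r (fun x => u x ^+ 2 * p x) <= fine (iint (fun x => (u x ^+ 2 * p x)%:E)).
    move=> cu u2; have cup : continuous (fun x => u x ^+ 2 * p x).
      by apply: continuous_mul => //; under eq_fun do rewrite expr2; exact: continuous_mul.
    have up0 x : 0 <= u x ^+ 2 * p x by rewrite mulr_ge0 ?sqr_ge0// ltW.
    split => // r r0; rewrite -lee_fin fineK; first by apply: boxI_le_iint => //; lra.
    by rewrite ge0_fin_numE//; apply: iint_ge0 => x; rewrite lee_fin.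
  have [cfp fb] := h1 f cf f2; have [cgp gb] := h1 g cg g2.
  exists (2 * fine (iint (fun x => (f x ^+ 2 * p x)%:E)) +
          2 * fine (iint (fun x => (g x ^+ 2 * p x)%:E))) => s s0.
  have rr : - s <= s by lra.
  have cfg : continuous (fun x => f x - g x) by apply: continuous_add => //; exact: continuous_opp.
  have c2f : continuous (fun x => 2 * (f x ^+ 2 * p x)).
    by apply: continuous_mul => //; exact: continuous_cst.
  have c2g : continuous (fun x => 2 * (g x ^+ 2 * p x)).
    by apply: continuous_mul => //; exact: continuous_cst.
  apply: (@le_trans _ _ (boxI (- s) s (fun x => 2 * (f x ^+ 2 * p x) + 2 * (g x ^+ 2 * p x)))).
    apply: le_boxI => //.
    - by apply: continuous_mul => //; under eq_fun do rewrite expr2; exact: continuous_mul.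
    - exact: continuous_add.
    - move=> x _; have := pos x; have := sqr_ge0 (f x + g x); rewrite sqrrD sqrrB.
      by move=> ? ?; nra.
  by rewrite boxID// !boxIZ// lerD// ler_wpM2l// ?fb ?gb.
have [C hC] := bound _ _ (hasdx_continuous hS) (hasdx_continuous hq) S2 q2.
have exD i : exists D, forall r, 0 < r ->
   boxI (- r) r (fun x => p x * (dS i x - dq i x) ^+ 2) <= D.
  exact: bound (hasdx_continuous (hdS i)) (hasdx_continuous (hdq i)) (dS2 i) (dq2 i).
have [D hD] := choice exD.
have sumD : 0 <= \sum_i `|D i| by apply: sumr_ge0.
apply: (@energy_cst R d _ _ _ _ _ pos hp hh hdh pde (`|C| + \sum_i `|D i|)).
  by move=> r0 r00; have := hC r0 r00; have := ler_norm C; lra.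
move=> r0 i r00; have := hD i r0 r00; have := ler_norm (D i).
rewrite (bigD1 i)//=.
have : 0 <= \sum_(j < d | j != i) `|D j| by apply: sumr_ge0.
by have := normr_ge0 C; lra.
Qed.

(** * Sub-Gaussian growth *)

Section SubGaussianGrowth.
Context {R : realType} {d : nat}.
Implicit Types (f g : 'rV[R]_d -> R).

Definition sqnorm (x : 'rV[R]_d) : R := \sum_i x 0 i ^+ 2.

Lemma sqnorm_ge0 x : 0 <= sqnorm x.
Proof. by apply: sumr_ge0 => i _; exact: sqr_ge0. Qed.

(** Growth slower than every Gaussian. The class contains the polynomials and is closed under
    products, since [e] can be split between two factors. *)
Definition subexp f := forall e, 0 < e ->
  exists2 C, 0 <= C & forall x, `|f x| <= C * expR (e * sqnorm x).

Lemma subexp_cst k : subexp (fun=> k).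
Proof.
move=> e e0; exists `|k| => // x; rewrite -[leLHS]mulr1 ler_wpM2l//.
by rewrite -expR0 ler_expR mulr_ge0 ?sqnorm_ge0// ltW.
Qed.

Lemma subexp_coord i : subexp (fun x => x 0 i).
Proof.
move=> e e0; exists (1 + e^-1) => [|x].
  by rewrite addr_ge0// invr_ge0 ltW.
have xi : x 0 i ^+ 2 <= sqnorm x.
  by rewrite /sqnorm (bigD1 i)//= lerDl sumr_ge0// => j _; exact: sqr_ge0.
(* The product is at least [1 + x_i ^ 2], which dominates [|x_i|], and [1 + z <= expR z]. *)
apply: (@le_trans _ _ ((1 + e^-1) * (1 + e * sqnorm x))).
  rewrite mulrDl mul1r mulrDr mulr1 mulKf ?gt_eqF//.
  have := sqr_ge0 (`|x 0 i| - 1); rewrite sqrrB real_normK ?num_real// => ?.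
  have : 0 < e^-1 by rewrite invr_gt0.
  have : 0 <= e * sqnorm x by rewrite mulr_ge0 ?sqnorm_ge0// ltW.
  have := normr_ge0 (x 0 i); nra.
apply: ler_wpM2l; last exact: expR_ge1Dx.
by rewrite addr_ge0// invr_ge0 ltW.
Qed.

Lemma subexpD f g : subexp f -> subexp g -> subexp (fun x => f x + g x).
Proof.
move=> sf sg e e0; have [C C0 fC] := sf e e0; have [D D0 gD] := sg e e0.
exists (C + D) => [|x]; first exact: addr_ge0.
by apply: (le_trans (ler_normD _ _)); rewrite mulrDl lerD.
Qed.

Lemma subexpM f g : subexp f -> subexp g -> subexp (fun x => f x * g x).
Proof.
move=> sf sg e e0; have e2 : 0 < e / 2 by lra.
have [C C0 fC] := sf _ e2; have [D D0 gD] := sg _ e2.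
exists (C * D) => [|x]; first exact: mulr_ge0.
rewrite normrM; apply: (le_trans (ler_pM _ _ (fC x) (gD x))) => //.
by rewrite mulrACA -expRD -mulrDl -splitr.
Qed.

Lemma subexp_sum (I : Type) (r : seq I) (F : I -> 'rV[R]_d -> R) :
  (forall i, subexp (F i)) -> subexp (fun x => \sum_(i <- r) F i x).
Proof.
move=> sF; elim: r => [|i r IH].
  by under eq_fun do rewrite big_nil; exact: subexp_cst.
by under eq_fun do rewrite big_cons; exact: subexpD.
Qed.

Lemma subexpX f n : subexp f -> subexp (fun x => f x ^+ n).
Proof.
move=> sf; elim: n => [|n IH]; first by under eq_fun do rewrite expr0; exact: subexp_cst.
by under eq_fun do rewrite exprS; exact: subexpM.
Qed.

End SubGaussianGrowth.

(** * Integration against a weight with Gaussian decay *)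

Section GaussianWeight.
Context {R : realType}.

Lemma integrable_expRN_sqr (a : R) : 0 < a ->
  (@lebesgue_measure R).-integrable setT (EFin \o (fun t => expR (- (a * t ^+ 2)))).
Proof.
(* The normal density of variance [1 / (2 a)] has exponent [- a t ^ 2]. *)
move=> a0; pose s := Num.sqrt (2 * a)^-1.
have s0 : s != 0 by rewrite gt_eqF// sqrtr_gt0 invr_gt0; lra.
have pk : 0 < normal_peak s by exact: normal_peak_gt0.
have E : (EFin \o (fun t => expR (- (a * t ^+ 2)))) =
    (fun t => ((normal_peak s)^-1)%:E * (normal_pdf 0 s t)%:E)%E.
  apply/funext => t /=; rewrite normal_pdfE// -EFinM mulKf ?gt_eqF//.
  congr (expR _)%:E; rewrite subr0 mulNr; congr (- _).
  rewrite /s sqr_sqrtr; last by rewrite invr_ge0; lra.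
  by rewrite -mulr_natr; field; rewrite gt_eqF.
rewrite E; apply: integrableZl => //; exact: integrable_normal_pdf.
Qed.

Context {d : nat} (p : 'rV[R]_d -> R) (cp : continuous p)
  (P0 a : R) (P00 : 0 <= P0) (a0 : 0 < a)
  (pb : forall x, `|p x| <= P0 * expR (- (a * sqnorm x))).

Lemma subexp_mul_weight_le f : subexp f ->
  exists2 C, 0 <= C & forall x, `|f x * p x| <= C * expR (- (a / 2 * sqnorm x)).
Proof.
move=> sf; have a2 : 0 < a / 2 by rewrite divr_gt0.
have [C C0 fC] := sf _ a2; exists (C * P0) => [|x]; first exact: mulr_ge0.
rewrite normrM; apply: (le_trans (ler_pM _ _ (fC x) (pb x))) => //.
rewrite mulrACA -expRD ler_wpM2l ?mulr_ge0// ler_expR; lra.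
Qed.

Lemma iint_subexp f : subexp f -> continuous f ->
  exists2 l, iint (fun x => (f x * p x)%:E) = l%:E &
    boxI (- N%:R) N%:R (fun x => f x * p x) @[N --> \oo] --> l.
Proof.
move=> sf cf; have [C C0 fC] := subexp_mul_weight_le sf.
pose k t : R := expR (- (a / 2 * t ^+ 2)).
have a2 : 0 < a / 2 by rewrite divr_gt0.
apply: (@iint_dominated _ k _ _ _ _ C) => //.
- have h : continuous (fun t : R => - (a / 2 * (t * t))).
    apply: continuous_opp; apply: continuous_mul; first exact: continuous_cst.
    by apply: continuous_mul => ?; exact: cvg_id.
  move=> t; apply: (@continuous_comp _ _ _ (fun t : R => - (a / 2 * (t * t))) expR).
    exact: h.
  exact: continuous_expR.
- by move=> t; exact: expR_ge0.
- exact: integrable_expRN_sqr.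
- exact: continuous_mul.
- move=> x; apply: (le_trans (fC x)); apply: ler_wpM2l => //.
  by rewrite /prodk /k -expR_sum sumrN -mulr_sumr.
Qed.

(** Shows that a mean is zero by exhibiting the integrand as a divergence. The limit is recorded
    next to [iint] because later arguments add integrals on cubes. *)
Lemma iint_divergence (w : 'I_d -> 'rV[R]_d -> R) dw q :
  (forall i, hasdx (fun x => w i x * p x) (dw i)) -> (forall i, subexp (w i)) ->
  subexp q -> continuous q -> (forall x, \sum_i dw i i x = q x * p x) ->
  iint (fun x => (q x * p x)%:E) = 0%E /\
  boxI (- N%:R) N%:R (fun x => q x * p x) @[N --> \oo] --> (0 : R).
Proof.
move=> hw sw sq cq dwE.
have [l lE lim] := iint_subexp sq cq.
suff l0 : boxI (- N%:R) N%:R (fun x => q x * p x) @[N --> \oo] --> (0 : R).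
  split => //; rewrite lE; congr _%:E.
  exact: (cvg_unique _ lim l0).
(* The power [d + 1] beats the growth of the faces: on the face [|x_i| = N] the field is
   O(N^-(d+1)), the faces have total area O(N^(d-1)), and the flux is at most [K / N ^ 2]. *)
have exC i : exists C, 0 <= C /\
    forall x : 'rV[R]_d, `|x 0 i ^+ d.+1 * (w i x * p x)| <= C.
  have [C C0 h] := subexp_mul_weight_le (subexpM (subexpX d.+1 (subexp_coord i)) (sw i)).
  exists C; split => // x; rewrite mulrA; apply: (le_trans (h x)).
  rewrite -[leRHS]mulr1 ler_wpM2l// -expR0 ler_expR oppr_le0.
  by apply: mulr_ge0; [apply: divr_ge0 => //; exact: ltW|exact: sqnorm_ge0].
have [C HC] := choice exC.
pose C1 := \sum_i C i.
have CC1 i : C i <= C1.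
  rewrite /C1 (bigD1 i)//= lerDl sumr_ge0// => j _; by have [] := HC j.
pose K := 2 ^+ d * d%:R * C1.
apply/cvgrPdist_le => e e0.
exists (Num.truncn (K / e)).+1 => // N /= HN.
rewrite sub0r normrN.
have N1 : 1 <= N%:R :> R by rewrite ler1n (leq_trans _ HN).
have N0 : 0 < N%:R :> R by lra.
have KN : K / e < N%:R.
  by apply: (lt_le_trans (truncnS_gt _)); rewrite ler_nat.
have cD : continuous (fun x => \sum_i dw i i x).
  under eq_fun do rewrite dwE; exact: continuous_mul.
have := boxI_divergence_le (M := C1 / N%:R ^+ d.+1) N0 hw cD.
under eq_boxI do rewrite dwE.
move=> /(_ _)/le_trans; apply.
  move=> i x _ xN; have [_ /(_ x)] := HC i.
  rewrite normrM normrX xN => h; rewrite ler_pdivlMr ?exprn_gt0// mulrC.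
  exact: le_trans h (CC1 i).
rewrite -[N%:R *+ 2]mulr_natl exprMn.
have -> : 2 ^+ d * N%:R ^+ d * (d%:R * (C1 / N%:R ^+ d.+1) / N%:R) = K / N%:R / N%:R.
  by rewrite /K exprS; field; rewrite expf_neq0 gt_eqF.
have KeN : K <= e * N%:R by move: KN; rewrite ltr_pdivrMr// mulrC => /ltW.
rewrite ler_pdivrMr// ler_pdivrMr//; apply: (le_trans KeN).
by apply: ler_peMr => //; apply: mulr_ge0 => //; exact: ltW.
Qed.

End GaussianWeight.

(** * Positive definite matrices *)

Lemma continuous_prod (R : realType) (T : topologicalType) (I : Type) (r : seq I)
    (F : I -> T -> R) :
  (forall i, continuous (F i)) -> continuous (fun x => \prod_(i <- r) F i x).
Proof.
move=> cF; elim: r => [|i r IH].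
  by under eq_fun do rewrite big_nil; exact: continuous_cst.
by under eq_fun do rewrite big_cons; exact: continuous_mul.
Qed.

Section PositiveDefinite.
Context {R : realType} {d : nat}.
Implicit Types (M B C N : 'M[R]_d).

Lemma mx11_quad_tr B (y : 'rV[R]_d) : (y *m B *m y^T) 0 0 = \tr (B *m (y^T *m y)).
Proof.
transitivity (\tr (y *m B *m y^T)); first by rewrite /mxtrace big_ord1.
by rewrite mxtrace_mulC [RHS]mxtrace_mulC !mulmxA.
Qed.

Lemma spd_quad_ge0 M (v : 'rV[R]_d) : spd M -> 0 <= (v *m M *m v^T) 0 0.
Proof.
move=> [_ M0]; have [->|v0] := eqVneq v 0; last exact/ltW/M0.
by rewrite !mul0mx mxE.
Qed.

Lemma spd_unitmx M : spd M -> M \in unitmx.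
Proof.
move=> [_ M0]; rewrite unitmxE unitfE; apply/negP => /det0P[v v0 vM].
by have := M0 v v0; rewrite vM mul0mx mxE ltxx.
Qed.

Lemma spd1 : spd (1%:M : 'M[R]_d).
Proof.
split=> [|v v0]; first exact: trmx1.
rewrite mulmx1 mxE; under eq_bigr do rewrite mxE -expr2.
rewrite lt_neqAle sumr_ge0 ?andbT => [|i _]; last exact: sqr_ge0.
rewrite eq_sym psumr_eq0 => [|i _]; last exact: sqr_ge0.
apply: contra v0 => /allP h; apply/eqP/rowP => i; rewrite mxE.
by have := h i (mem_index_enum i); rewrite /= sqrf_eq0 => /eqP.
Qed.

Lemma spd_sqr M : spd M -> spd (M *m M).
Proof.
move=> sM; have [MT _] := sM; split; first by rewrite trmx_mul MT.
move=> v v0; have vM0 : v *m M != 0.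
  apply: contra v0 => /eqP vM.
  by rewrite -[v](mulmxK (spd_unitmx sM)) vM mul0mx.
have [_ /(_ _ vM0)] := spd1.
by rewrite mulmx1 trmx_mul MT !mulmxA.
Qed.

(** The trace is the sum of the quadratic form of [M] over the rows of [N]. *)
Lemma spd_tr_ge0 M N : spd M -> 0 <= \tr (N *m M *m N^T) ?= iff (N == 0).
Proof.
move=> sM; have trE : \tr (N *m M *m N^T) = \sum_i (row i N *m M *m (row i N)^T) 0 0.
  by apply: eq_bigr => i _; rewrite tr_row -row_mul !mxE; apply: eq_bigr => j _; rewrite !mxE.
have ge0 i : 0 <= (row i N *m M *m (row i N)^T) 0 0 by exact: spd_quad_ge0.
split; first by rewrite trE sumr_ge0.
rewrite eq_sym; apply/idP/eqP => [|->]; last by rewrite !mul0mx mxtrace0.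
rewrite trE psumr_eq0 => [/allP h|i _]; last exact: ge0.
apply/row_matrixP => i; rewrite row0; apply/eqP/negPn/negP => ri.
have := h i (mem_index_enum i); rewrite /=.
by have [_ /(_ _ ri)] := sM; rewrite lt0r => /andP[/negbTE ->].
Qed.

(** Multiplying by [B^T] and taking the trace gives two nonnegative terms with sum 0; [B] may be any
    square matrix. *)
Lemma lyapunov_inj M B : spd M -> M *m B + B *m M = 0 -> B = 0.
Proof.
move=> sM MB.
have : \tr (B^T *m M *m B^T^T) + \tr (B *m M *m B^T) = 0.
  rewrite trmxK -[\tr (B *m M *m B^T)]mxtrace_mulC -mulmxA -mxtraceD -mulmxDr.
  by rewrite MB mulmx0 mxtrace0.
have h1 := (spd_tr_ge0 B^T sM).1; have h2 := (spd_tr_ge0 B sM).1.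
move=> h; apply/eqP; rewrite -(spd_tr_ge0 B sM).2 eq_le h2 /=; lra.
Qed.

(** An injective endomorphism of the finite-dimensional space of matrices is onto; [mxvec] turns it
    into a square matrix with trivial kernel. *)
Lemma lyapunov_exists M C : spd M -> exists B, M *m B + B *m M = C.
Proof.
move=> sM; pose G : 'M[R]_(d * d) := lin_mulmx M + lin_mulmxr M.
have GE B : mxvec B *m G = mxvec (M *m B + B *m M).
  by rewrite mulmxDr !mul_vec_lin /= linearD.
have uG : G \in unitmx.
  rewrite -row_free_unit -kermx_eq0; apply/eqP/row_matrixP => i; rewrite row0.
  have : row i (kermx G) *m G = 0 by rewrite -row_mul mulmx_ker row0.
  rewrite -[row i (kermx G)]vec_mxK GE => /eqP.
  by rewrite mxvec_eq0 => /eqP/(lyapunov_inj sM) ->; rewrite linear0.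
exists (vec_mx (mxvec C *m invmx G)).
by apply: (can_inj mxvecK); rewrite -GE vec_mxK mulmxKV.
Qed.

(** The transpose solves the same equation. *)
Lemma lyapunov_sym M B : spd M -> (M *m B + B *m M)^T = M *m B + B *m M -> B^T = B.
Proof.
move=> sM; have [MT _] := sM; rewrite linearD /= !trmx_mul MT => h.
apply/eqP; rewrite -subr_eq0; apply/eqP/(lyapunov_inj sM).
by rewrite mulmxBr mulmxBl addrACA -opprD -h [B^T *m M + _]addrC subrr.
Qed.

Lemma sym_tr_delta_eq0 N : N^T = N ->
  (forall i j : 'I_d, (i <= j)%N -> \tr ((delta_mx i j + delta_mx j i) *m N) = 0) -> N = 0.
Proof.
move=> NT h.
have trd i j : \tr (delta_mx i j *m N) = N j i.
  rewrite /mxtrace (bigD1 i)//= big1 ?addr0 => [|k ki].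
    rewrite mxE (bigD1 j)//= big1 ?addr0 => [|l lj]; rewrite mxE eqxx.
      by rewrite eqxx mul1r.
    by rewrite (negbTE lj) mul0r.
  by rewrite mxE big1// => l _; rewrite mxE (negbTE ki) mul0r.
have le_case (i j : 'I_d) : (i <= j)%N -> N i j = 0.
  move=> ij; have := h i j ij; rewrite mulmxDl mxtraceD !trd.
  have -> : N j i = N i j by rewrite -[in LHS]NT mxE.
  by lra.
apply/matrixP => i j; rewrite [RHS]mxE.
have [ij|ji] := leqP i j; first exact: le_case.
by rewrite -NT mxE le_case// ltnW.
Qed.

(** The two clauses serve the Leibniz expansion of det(1 + s N) at [s = 0]: all factors of the
    identity permutation equal 1, and any other permutation has at least two vanishing factors. *)
Lemma is_derive_bigprod0 (I : eqType) (r : seq I) (f : I -> R -> R) (f' : I -> R) :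
  (forall i, is_derive (0 : R) 1 (f i) (f' i)) ->
  exists v, is_derive (0 : R) 1 (fun s => \prod_(i <- r) f i s) v /\
    ((forall i, f i 0 = 1) -> v = \sum_(i <- r) f' i) /\
    ((1 < count (fun i => f i 0%R == 0%R) r)%N -> v = 0).
Proof.
move=> hf; elim: r => [|i r [v [h1 [h2 h3]]]].
  exists 0; split; last by split => //; rewrite big_nil.
  under eq_fun do rewrite big_nil; exact: is_derive_cst.
have -> : (fun s => \prod_(k <- i :: r) f k s) = f i * (fun s => \prod_(k <- r) f k s).
  by apply/funext => s; rewrite big_cons.
exists (f i 0 *: v + (\prod_(k <- r) f k 0) *: f' i); split.
  exact: is_deriveM.
rewrite /GRing.scale/=; split => [f1|].
  have -> : \prod_(k <- r) f k 0 = 1 by apply: big1 => k _; exact: f1.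
  by rewrite f1 !mul1r h2// big_cons addrC.
rewrite /=; have prod0 : (0 < count (fun i => f i 0%R == 0%R) r)%N -> \prod_(k <- r) f k 0 = 0.
  by rewrite -has_count => /hasP[k kr /eqP k0]; rewrite (big_rem k)//= k0 mul0r.
case: eqP => [->|_]; rewrite ?add1n ?add0n => h.
  by rewrite mul0r add0r prod0// mul0r.
by rewrite h3// mulr0 add0r prod0 ?mul0r// ltnW.
Qed.

Lemma is_derive_bigsum (I : Type) (r : seq I) (F : I -> R -> R) (F' : I -> R) x :
  (forall i, is_derive (x : R) 1 (F i) (F' i)) ->
  is_derive x 1 (fun s => \sum_(i <- r) F i s) (\sum_(i <- r) F' i).
Proof.
move=> hF; elim: r => [|i r IH].
  by under eq_fun do rewrite big_nil; rewrite big_nil; exact: is_derive_cst.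
by under eq_fun do rewrite big_cons; rewrite big_cons; exact: is_deriveD.
Qed.

Lemma is_derive_det1 N : is_derive (0 : R) 1 (fun s => \det (1%:M + s *: N)) (\tr N).
Proof.
pose f (s : 'S_d) (i : 'I_d) (t : R) := (i == s i)%:R + t * N i (s i).
have df s i : is_derive (0 : R) 1 (f s i) (N i (s i)).
  apply: is_derive_eq; rewrite /GRing.scale/=; ring.
have ex s := is_derive_bigprod0 (index_enum 'I_d) (df s).
have [v hv] := choice ex.
have -> : (fun s => \det (1%:M + s *: N)) =
    (fun t => \sum_(s : 'S_d) (-1) ^+ s * \prod_i f s i t).
  apply/funext => t; apply: eq_bigr => s _; congr (_ * _).
  by apply: eq_bigr => i _; rewrite !mxE.
have -> : \tr N = \sum_(s : 'S_d) (-1) ^+ s * v s.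
  rewrite (bigD1 (1%g : 'S_d))//= big1 ?addr0 => [|s s1].
    have [_ [h _]] := hv (1%g : 'S_d).
    rewrite h => [|i]; last by rewrite /f perm1 eqxx mul0r addr0.
    by rewrite odd_perm1 mul1r; apply: eq_bigr => i _; rewrite perm1.
  have [_ [_ h]] := hv s; rewrite h ?mulr0//.
  have f0 k : (f s k 0 == 0) = (k != s k).
    by rewrite /f mul0r addr0; case: (k == s k); rewrite ?oner_eq0 ?eqxx.
  rewrite (eq_count f0) -sum1_count sum1_card; apply/card_gt1P.
  have /existsP[i si] : [exists i, i != s i].
    rewrite -[X in is_true X]negbK negb_exists; apply: contra s1 => /forallP s1.
    by apply/eqP/permP => i; rewrite perm1; have := s1 i; rewrite negbK => /eqP.
  (* A moved point and its image are two distinct moved points. *)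
  by exists i, (s i); split; rewrite ?unfold_in /= ?(inj_eq perm_inj).
apply: is_derive_bigsum => s.
have := @is_deriveZ _ _ _ (fun t => \prod_i f s i t) ((-1) ^+ s) _ _ _ (hv s).1.
by [].
Qed.

(** Jacobi's formula, reduced to the identity by factoring out [M]. *)
Lemma is_derive_det M N : M \in unitmx ->
  is_derive (0 : R) 1 (fun s => \det (M + s *: N)) (\det M * \tr (invmx M *m N)).
Proof.
move=> uM.
have -> : (fun s => \det (M + s *: N)) = (\det M) \*: (fun s => \det (1%:M + s *: (invmx M *m N))).
  apply/funext => s.
  rewrite -[RHS]/(\det M * \det (1%:M + s *: (invmx M *m N))).
  by rewrite -det_mulmx mulmxDr mulmx1 -scalemxAr mulKVmx.
exact: is_deriveZ (is_derive_det1 _).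
Qed.

(** The segment from the identity to [M] consists of positive definite matrices, so the determinant
    does not vanish along it and keeps the sign it has at the identity. *)
Lemma spd_det_gt0 M : spd M -> 0 < \det M.
Proof.
move=> sM.
have dM0 s : 0 <= s <= 1 -> \det (1%:M + s *: (M - 1%:M)) != 0.
  move=> s01; rewrite -unitfE -unitmxE; apply: spd_unitmx; split.
    by rewrite linearD /= linearZ /= linearB /= trmx1 (sM.1).
  move=> v v0.
  rewrite (_ : 1%:M + _ = (1 - s) *: 1%:M + s *: M); last first.
    by rewrite scalerBr scalerBl scale1r addrCA addrC -addrA.
  have := sM.2 v v0; have := spd1.2 v v0.
  rewrite mulmxDr mulmxDl -!scalemxAr -!scalemxAl.
  rewrite [X in _ -> _ -> 0 < X]mxE [X in _ -> _ -> 0 < X + _]mxE [X in _ -> _ -> 0 < _ + X]mxE.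
  set a := fun_of_matrix _ _ _; set b := fun_of_matrix _ _ _ => a0 b0.
  nra.
rewrite lt_neqAle; apply/andP; split.
  by have := dM0 1; rewrite scale1r addrC subrK eq_sym; apply; lra.
rewrite leNgt; apply/negP => dM.
pose D s := \det (1%:M + s *: (M - 1%:M)).
have D0 : D 0 = 1 by rewrite /D scale0r addr0 det1.
have D1 : D 1 = \det M by rewrite /D scale1r addrC subrK.
have cD : continuous D.
  apply: continuous_sum => s; apply: continuous_mul; first exact: continuous_cst.
  apply: continuous_prod => i; under eq_fun do rewrite !mxE.
  apply: continuous_add; first exact: continuous_cst.
  by apply: continuous_mul; [move=> x; exact: cvg_id|exact: continuous_cst].
have [|c c01 /eqP] := @IVT R D 0 1 0 ler01 (continuous_subspaceT cD).
  by rewrite D0 D1 ge_min le_max ler01 (ltW dM) orbT.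
by rewrite (negbTE (dM0 c _)).
Qed.

End PositiveDefinite.

(** * The Gaussian model *)

Section GaussianModel.
Context {R : realType} {d : nat} (mu : 'rV[R]_d) (L : 'M[R]_d) (sL : spd L).
Implicit Types (B E : 'M[R]_d) (x v : 'rV[R]_d).

Local Notation A := (L *m L).
Local Notation p := (fun x => pdens (@gauss R d) x mu L).

(** Quadratic forms in [x - mu] are written as sums of products of these linear forms, so that
    derivatives and growth follow from the sum and product rules. *)
Definition clin B j x : R := ((x - mu) *m B) 0 j.

Lemma clinE B j x : clin B j x = \sum_k (x 0 k - mu 0 k) * B k j.
Proof. by rewrite /clin mxE; apply: eq_bigr => k _; rewrite !mxE. Qed.

Lemma clin1 j x : clin 1%:M j x = x 0 j - mu 0 j.
Proof. by rewrite /clin mulmx1 !mxE. Qed.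

Lemma sum_clinM B C x : \sum_j clin B j x * clin C j x =
  ((x - mu) *m (B *m C^T) *m (x - mu)^T) 0 0.
Proof.
rewrite mulmxA -mulmxA -trmx_mul mxE.
by apply: eq_bigr => j _; congr (_ * _); rewrite mxE.
Qed.

Lemma sum_clinMl B v x : \sum_j clin B j x * v 0 j = ((x - mu) *m B *m v^T) 0 0.
Proof. by rewrite mxE; apply: eq_bigr => j _; congr (_ * _); rewrite mxE. Qed.

Lemma hasdx_clin B j : hasdx (clin B j) (fun i _ => B i j).
Proof.
apply: (eq_hasdx (hasdx_sum (index_enum 'I_d) (fun k =>
  hasdxM (hasdxD (hasdx_coord k) (hasdx_cst (- mu 0 k))) (hasdx_cst (B k j))))).
  by move=> x; rewrite clinE.
move=> i x /=; rewrite (bigD1 i)//= eqxx big1 ?addr0 => [|k ki].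
  by rewrite mulr0 !addr0 mul1r.
by rewrite (negbTE ki) !mulr0 !addr0 mul0r.
Qed.

Lemma subexp_clin B j : subexp (clin B j).
Proof.
rewrite (_ : clin B j = fun x => \sum_k (x 0 k - mu 0 k) * B k j); last first.
  by apply/funext => x; rewrite clinE.
apply: subexp_sum => k; apply: subexpM; last exact: subexp_cst.
by apply: subexpD; [exact: subexp_coord|exact: subexp_cst].
Qed.

Lemma pdens_gaussE x : pdens (@gauss R d) x mu L =
  \det L * (2 * pi) `^ (- (d%:R / 2)) * expR (- 2^-1 * \sum_j clin L j x ^+ 2).
Proof.
rewrite /pdens /gauss mulrA; congr (_ * expR _).
by rewrite mulNr [_ / 2]mulrC mulNr.
Qed.

Lemma pdens_gt0 x : 0 < pdens (@gauss R d) x mu L.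
Proof.
rewrite pdens_gaussE !mulr_gt0 ?expR_gt0 ?spd_det_gt0// powR_gt0// mulr_gt0//.
exact: pi_gt0.
Qed.

Lemma hasdx_pdens : hasdx p (fun i x => - clin A i x * p x).
Proof.
have [LT _] := sL.
have hq := hasdxZ (- 2^-1) (hasdx_sum (index_enum 'I_d)
  (fun j => hasdxM (hasdx_clin L j) (hasdx_clin L j))).
have he := hasdxZ (\det L * (2 * pi) `^ (- (d%:R / 2)))
  (hasdx_comp (u := expR) (u' := expR) (fun t => is_derive_expR t) hq).
apply: (eq_hasdx he) => [x|i x].
  by rewrite pdens_gaussE; under [in RHS]eq_bigr do rewrite expr2.
rewrite pdens_gaussE; under [in RHS]eq_bigr do rewrite expr2.
rewrite [RHS]mulrC -[RHS]mulrA; congr (_ * (_ * _)).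
have -> : clin A i x = \sum_j clin L j x * L i j.
  rewrite /clin mulmxA mxE; apply: eq_bigr => j _; congr (_ * _).
  by rewrite -[in LHS]LT mxE.
by rewrite -sumrN mulr_sumr; apply: eq_bigr => j _; field.
Qed.

Lemma continuous_pdens : continuous p.
Proof. exact: hasdx_continuous hasdx_pdens. Qed.

Lemma pdens_le : exists P0 a, [/\ 0 <= P0, 0 < a &
  forall x, `|p x| <= P0 * expR (- (a * sqnorm x))].
Proof.
pose W := invmx L.
(* The sum is a crude bound for the squared operator norm of the inverse of [L]; the 1 makes it
   positive. *)
pose w := 1 + \sum_i (\sum_j `|W j i|) ^+ 2.
have w0 : 0 < w.
  have : 0 <= \sum_i (\sum_j `|W j i|) ^+ 2 by apply: sumr_ge0 => i _; exact: sqr_ge0.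
  by rewrite /w; lra.
pose Q x := \sum_j clin L j x ^+ 2.
have Q0 x : 0 <= Q x by apply: sumr_ge0 => i _; exact: sqr_ge0.
have yQ x : sqnorm (x - mu) <= w * Q x.
  apply: (@le_trans _ _ ((\sum_i (\sum_j `|W j i|) ^+ 2) * Q x)); last first.
    by apply: ler_wpM2r => //; rewrite /w; lra.
  rewrite mulr_suml; apply: ler_sum => i _.
  have -> : (x - mu) 0 i = \sum_j clin L j x * W j i.
    by rewrite -[in LHS](mulmxK (spd_unitmx sL) (x - mu)) mxE.
  rewrite -[Q x]sqr_sqrtr// -exprMn -[leLHS]real_normK ?num_real//.
  rewrite lerXn2r ?nnegrE// ?mulr_ge0 ?sqrtr_ge0 ?sumr_ge0//.
  apply: (le_trans (ler_norm_sum _ _ _)); rewrite mulr_suml; apply: ler_sum => j _.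
  rewrite normrM mulrC ler_wpM2l// -sqrtr_sqr ler_wsqrtr//.
  by rewrite /Q (bigD1 j)//= lerDl sumr_ge0// => k _; exact: sqr_ge0.
have xy x : sqnorm x <= 2 * sqnorm (x - mu) + 2 * sqnorm mu.
  rewrite /sqnorm !mulr_sumr -big_split/=; apply: ler_sum => i _; rewrite !mxE.
  by have := sqr_ge0 (x 0 i - 2 * mu 0 i); nra.
pose c := \det L * (2 * pi) `^ (- (d%:R / 2)).
have c0 : 0 <= c.
  by rewrite mulr_ge0 ?powR_ge0// ltW// spd_det_gt0.
(* With the rate [(4 * w)^-1], the term [2 * (w * Q x)] becomes exactly the Gaussian exponent
   [Q x / 2]. *)
exists (c * expR ((4 * w)^-1 * (2 * sqnorm mu))), (4 * w)^-1.
have a0 : 0 < (4 * w)^-1 by rewrite invr_gt0; lra.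
split => // [|x]; first by rewrite mulr_ge0 ?expR_ge0.
rewrite pdens_gaussE ger0_norm; last by rewrite mulr_ge0// expR_ge0.
rewrite -[leRHS]mulrA -expRD; apply: ler_wpM2l => //; rewrite ler_expR -/(Q x).
have : (4 * w)^-1 * sqnorm x <= (4 * w)^-1 * (2 * (w * Q x) + 2 * sqnorm mu).
  by rewrite ler_pM2l//; have := yQ x; have := xy x; lra.
have -> : (4 * w)^-1 * (2 * (w * Q x) + 2 * sqnorm mu) =
   2^-1 * Q x + (4 * w)^-1 * (2 * sqnorm mu) by field; rewrite gt_eqF.
lra.
Qed.

(** The bracket is the derivative of the [j]-th coordinate of [(x - mu) *m L] along [(v, E)]; the
    trace comes from the logarithm of the determinant. *)
Definition gscore v E x : R :=
  \tr (invmx L *m E) - \sum_j clin L j x * (clin E j x - (v *m L) 0 j).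

Lemma is_derive_pdens v E x :
  is_derive (0 : R) 1 (fun s => pdens (@gauss R d) x (mu + s *: v) (L + s *: E))
    (p x * gscore v E x).
Proof.
pose c := (2 * pi : R) `^ (- (d%:R / 2)).
pose b j := clin E j x - (v *m L) 0 j.
pose e j := (v *m E) 0 j.
pose u j (s : R) := clin L j x + s * b j - s * s * e j.
have du j : is_derive (0 : R) 1 (u j) (b j).
  by apply: is_derive_eq; rewrite /GRing.scale/=; ring.
have uE s j : ((x - (mu + s *: v)) *m (L + s *: E)) 0 j = u j s.
  have ent (M1 M2 M3 M4 : 'rV[R]_d) t : (M1 + s *: (M2 - M3) - t *: M4) 0 j =
      M1 0 j + s * (M2 0 j - M3 0 j) - t * M4 0 j by rewrite !mxE.
  rewrite /u /b /e /clin -ent; congr (fun_of_matrix _ 0 j).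
  rewrite opprD addrA mulmxDr !mulmxBl -!scalemxAr -!scalemxAl scalerBr scalerBr scalerA.
  move: (x *m L - mu *m L) (s *: (v *m L)) (s *: (x *m E) - s *: (mu *m E)) => a0 b0 c0.
  by rewrite !addrA; congr (_ - _); exact: addrAC.
have dq : is_derive (0 : R) 1 (fun s => - 2^-1 * \sum_j u j s * u j s)
    (- \sum_j clin L j x * b j).
  have h := @is_derive_bigsum R _ (index_enum 'I_d) (fun j => u j * u j) _ 0
     (fun j => is_deriveM (du j) (du j)).
  have h2 := @is_deriveZ _ _ _ _ (- 2^-1) (0 : R) (1 : R) _ h.
  apply: (is_derive_eq h2); rewrite /GRing.scale/= mulr_sumr -sumrN; apply: eq_bigr => j _.
  by rewrite /u; field.
have dex := @is_derive1_comp R expR (fun s => - 2^-1 * \sum_j u j s * u j s) 0 _ _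
   (is_derive_expR _) dq.
have hall := is_deriveM (is_derive_det E (spd_unitmx sL))
   (@is_deriveZ _ _ _ _ c (0 : R) (1 : R) _ dex).
have -> : (fun s => pdens (@gauss R d) x (mu + s *: v) (L + s *: E)) =
  (fun s => \det (L + s *: E)) * (c \*: (expR \o (fun s => - 2^-1 * \sum_j u j s * u j s))).
  apply/funext => s; rewrite /pdens /gauss; congr (_ * (_ * expR _)).
  rewrite mulNr [_ / 2]mulrC mulNr; congr (- (_ * _)).
  by apply: eq_bigr => j _; rewrite uE expr2.
apply: (is_derive_eq hall).
rewrite scale0r addr0 /GRing.scale/= pdens_gaussE /gscore -/c.
have -> : \sum_j u j 0 * u j 0 = \sum_j clin L j x ^+ 2.
  by apply: eq_bigr => j _; rewrite /u expr2; ring.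
rewrite /b; rewrite -[c *: _]/(c * _); ring.
Qed.

Lemma dtheta_pdens k x : dtheta (fun m l => pdens (@gauss R d) x m l) k mu L =
  p x * gscore (pdir R k).1 (pdir R k).2 x.
Proof.
rewrite /dtheta derive1E; apply: derive_val.
exact: is_derive_pdens.
Qed.

Lemma dtheta_ln_pdens k x : dtheta (fun m l => ln (pdens (@gauss R d) x m l)) k mu L =
  gscore (pdir R k).1 (pdir R k).2 x.
Proof.
rewrite /dtheta derive1E; apply: derive_val.
have h := is_derive_pdens (pdir R k).1 (pdir R k).2 x.
have p0 : 0 < pdens (@gauss R d) x (mu + 0 *: (pdir R k).1) (L + 0 *: (pdir R k).2).
  by rewrite !scale0r !addr0; exact: pdens_gt0.
have := @is_derive1_comp R (@ln R) _ 0 _ _ (is_derive1_ln p0) h.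
move=> hc; apply: (is_derive_eq hc).
by rewrite !scale0r !addr0 mulKf// gt_eqF// pdens_gt0.
Qed.

End GaussianModel.

(** * The Wasserstein score *)

Section WassersteinScore.
Context {R : realType} {d : nat} (mu : 'rV[R]_d) (L : 'M[R]_d) (sL : spd L).
Implicit Types (B E : 'M[R]_d) (x v : 'rV[R]_d).

Local Notation A := (L *m L).
Local Notation p := (fun x => pdens (@gauss R d) x mu L).

Definition qscore v B x : R := \sum_j clin mu 1%:M j x * v 0 j -
  2^-1 * (\sum_j clin mu B j x * clin mu 1%:M j x - \tr (B *m invmx A)).

Lemma hasdx_qscore v B : B^T = B -> hasdx (qscore v B) (fun i x => v 0 i - clin mu B i x).
Proof.
move=> BT.
have h1 := hasdx_sum (index_enum 'I_d) (fun j =>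
  hasdxM (hasdx_clin mu 1%:M j) (hasdx_cst (v 0 j))).
have h2 := hasdx_sum (index_enum 'I_d) (fun j =>
  hasdxM (hasdx_clin mu B j) (hasdx_clin mu 1%:M j)).
have h := hasdxD h1 (hasdxN (hasdxZ 2^-1 (hasdxD h2 (hasdx_cst (- \tr (B *m invmx A)))))).
apply: (eq_hasdx h) => // i x.
have -> : \sum_(j < d) ((1%:M : 'M[R]_d) i j * v 0 j + clin mu 1%:M j x * 0) = v 0 i.
  rewrite (bigD1 i)//= mxE eqxx big1 => [|j ji]; first by rewrite mulr0 !addr0 mul1r.
  by rewrite mxE eq_sym (negbTE ji) mul0r mulr0 addr0.
rewrite big_split/=.
have -> : \sum_(j < d) B i j * clin mu 1%:M j x = clin mu B i x.
  rewrite clinE; apply: eq_bigr => j _.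
  by rewrite clin1 mulrC -[in LHS]BT mxE.
have -> : \sum_(j < d) clin mu B j x * (1%:M : 'M[R]_d) i j = clin mu B i x.
  rewrite (bigD1 i)//= mxE eqxx big1 => [|j ji]; first by rewrite mulr1 addr0.
  by rewrite mxE eq_sym (negbTE ji) mulr0.
by field.
Qed.

Lemma subexp_qscore v B : subexp (qscore v B).
Proof.
apply: subexpD.
  by apply: subexp_sum => j; apply: subexpM; [exact: subexp_clin|exact: subexp_cst].
under eq_fun do rewrite -mulN1r.
apply: subexpM; first exact: subexp_cst.
apply: subexpM; first exact: subexp_cst.
apply: subexpD; last exact: subexp_cst.
by apply: subexp_sum => j; apply: subexpM; exact: subexp_clin.
Qed.

Lemma gauss_iint f : subexp f -> continuous f ->
  exists2 l, iint (fun x => (f x * p x)%:E) = l%:E &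
    boxI (- N%:R) N%:R (fun x => f x * p x) @[N --> \oo] --> l.
Proof.
move=> sf cf; have [P0 [a [P00 a0 pb]]] := pdens_le mu sL.
exact: (iint_subexp (@continuous_pdens R d mu L sL) P00 a0 pb sf cf).
Qed.

Lemma qscore_mean0 v B : B^T = B ->
  iint (fun x => (qscore v B x * p x)%:E) = 0%E /\
  boxI (- N%:R) N%:R (fun x => qscore v B x * p x) @[N --> \oo] --> (0 : R).
Proof.
move=> BT; have [P0 [a [P00 a0 pb]]] := pdens_le mu sL.
have sA := spd_sqr sL; have uA := spd_unitmx sA; have [AT _] := sA.
have iAT : (invmx A)^T = invmx A by rewrite trmx_inv AT.
(* As grad p = - (x - mu) A p, the divergence of [w p] is [(div w - w . (x - mu) A) p]. The factor
   [invmx A] cancels [A] in the second term, and [div w] supplies half the trace. *)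
pose w i x := - (v *m invmx A) 0 i + 2^-1 * clin mu (B *m invmx A) i x.
have hw i : hasdx (w i) (fun k _ => 2^-1 * (B *m invmx A) k i).
  apply: (eq_hasdx (hasdxD (hasdx_cst _) (hasdxZ 2^-1 (hasdx_clin mu (B *m invmx A) i)))) => // k x.
  by rewrite add0r.
have hwp i := hasdxM (hw i) (hasdx_pdens mu sL).
apply: (iint_divergence (@continuous_pdens R d mu L sL) P00 a0 pb hwp).
- move=> i; apply: subexpD; first exact: subexp_cst.
  by apply: subexpM; [exact: subexp_cst|exact: subexp_clin].
- exact: subexp_qscore.
- exact: hasdx_continuous (hasdx_qscore v BT).
move=> x; rewrite big_split/= -mulr_suml -mulr_sumr.
under [X in _ + X = _]eq_bigr do rewrite mulrA mulrN.
rewrite -mulr_suml -mulrDl; congr (_ * _).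
rewrite sumrN /w.
under [X in _ - X = _]eq_bigr do rewrite mulrDl mulNr -mulrA.
rewrite big_split/= sumrN -mulr_sumr sum_clinM.
rewrite AT (mulmxKV uA).
rewrite /qscore sum_clinM trmx1 mulmx1 sum_clinMl mulmx1.
have -> : \sum_(i < d) (v *m invmx A) 0 i * clin mu A i x = ((x - mu) *m v^T) 0 0.
  under eq_bigr do rewrite mulrC.
  by rewrite sum_clinMl trmx_mul iAT -mulmxA mulKVmx//.
rewrite /mxtrace; ring.
Qed.

(** A quadratic form sees only the symmetric part of its matrix, here half the anticommutator. This
    matches the quadratic terms of the score equation. *)
Lemma lyapunov_quad B E x : B^T = B -> E^T = E -> A *m B + B *m A = L *m E + E *m L ->
  \sum_j clin mu A j x * clin mu B j x = \sum_j clin mu L j x * clin mu E j x.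
Proof.
move=> BT ET h; rewrite !sum_clinM BT ET.
have [LT _] := sL; have [AT _] := spd_sqr sL.
have sw C D : C^T = C -> D^T = D ->
    ((x - mu) *m (C *m D) *m (x - mu)^T) 0 0 = ((x - mu) *m (D *m C) *m (x - mu)^T) 0 0.
  move=> CT DT; transitivity (((x - mu) *m (C *m D) *m (x - mu)^T)^T 0 0).
    by rewrite [RHS]mxE.
  by rewrite !trmx_mul trmxK CT DT !mulmxA.
have dbl C D : C^T = C -> D^T = D ->
    2 * ((x - mu) *m (C *m D) *m (x - mu)^T) 0 0 =
    ((x - mu) *m (C *m D + D *m C) *m (x - mu)^T) 0 0.
  move=> CT DT; rewrite mulmxDr mulmxDl [RHS]mxE -(sw _ _ CT DT); ring.
have h1 := dbl _ _ AT BT; have h2 := dbl _ _ LT ET.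
by move: h1; rewrite h -h2; lra.
Qed.

(** Multiplying the equation by [invmx A] and taking the trace gives twice each side. This matches
    the constant terms of the score equation. *)
Lemma lyapunov_trace B E : A *m B + B *m A = L *m E + E *m L -> \tr B = \tr (invmx L *m E).
Proof.
move=> h; have uL := spd_unitmx sL; have uA := spd_unitmx (spd_sqr sL).
have := congr1 (fun M => \tr (invmx A *m M)) h.
have iAE : invmx A = invmx L *m invmx L.
  by apply: (can_inj (mulKmx uA)); rewrite mulmxV// mulmxA mulmxK// mulmxV.
have h1 : \tr (invmx A *m (A *m B)) = \tr B by rewrite mulKmx.
have h2 : \tr (invmx A *m (B *m A)) = \tr B by rewrite mxtrace_mulC mulmxK.
have h3 : \tr (invmx A *m (L *m E)) = \tr (invmx L *m E).
  by rewrite iAE -mulmxA mulKmx.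
have h4 : \tr (invmx A *m (E *m L)) = \tr (invmx L *m E).
  by rewrite iAE mxtrace_mulC mulmxA mulmxK// mxtrace_mulC.
rewrite !mulmxDr !mxtraceD h1 h2 h3 h4; lra.
Qed.

Lemma qscore_pde v B E x : B^T = B -> E^T = E ->
  A *m B + B *m A = L *m E + E *m L ->
  \sum_i ((- clin mu A i x * p x) * (v 0 i - clin mu B i x) + p x * - B i i) =
  - (p x * gscore mu L v E x).
Proof.
move=> BT ET h; have [LT _] := sL.
rewrite big_split/= -mulr_sumr sumrN.
have -> : \sum_(i < d) - clin mu A i x * p x * (v 0 i - clin mu B i x) =
    p x * (\sum_j clin mu A j x * clin mu B j x - \sum_j clin mu A j x * v 0 j).
  by rewrite -sumrB mulr_sumr; apply: eq_bigr => i _; ring.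
rewrite (lyapunov_quad x BT ET h) /gscore.
have -> : \sum_(j < d) clin mu L j x * (clin mu E j x - (v *m L) 0 j) =
    \sum_j clin mu L j x * clin mu E j x - \sum_j clin mu L j x * (v *m L) 0 j.
  by rewrite -sumrB; apply: eq_bigr => j _; ring.
rewrite (sum_clinMl _ _ v) (sum_clinMl _ _ (v *m L)) trmx_mul LT !mulmxA.
rewrite -(lyapunov_trace h) /mxtrace; ring.
Qed.

Lemma hasdx_dqscore v B i :
  hasdx (fun x => v 0 i - clin mu B i x) (fun k _ => - B k i).
Proof.
apply: (eq_hasdx (hasdxD (hasdx_cst (v 0 i)) (hasdxN (hasdx_clin mu B i)))) => // j x.
by rewrite add0r.
Qed.

Lemma subexp_dqscore v B i : subexp (fun x => v 0 i - clin mu B i x).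
Proof.
apply: subexpD; first exact: subexp_cst.
by under eq_fun do rewrite -mulN1r; apply: subexpM; [exact: subexp_cst|exact: subexp_clin].
Qed.

Lemma subexp_sqr_integrable f : subexp f -> continuous f ->
  (iint (fun x => (f x ^+ 2 * p x)%:E) < +oo)%E.
Proof.
move=> sf cf; have [||l -> _] := @gauss_iint (fun x => f x ^+ 2).
- exact: subexpX.
- by under eq_fun do rewrite expr2; exact: continuous_mul.
- exact: ltry.
Qed.

Lemma wscore_qscore k B : let E := (pdir R k).2 in
  B^T = B -> E^T = E -> A *m B + B *m A = L *m E + E *m L ->
  wscore (@gauss R d) k mu L (qscore (pdir R k).1 B).
Proof.
set v := (pdir R k).1 => E BT ET h.
have hS := hasdx_qscore v BT.
have dxS i : dx i (qscore v B) = fun x => v 0 i - clin mu B i x.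
  by apply/funext => x; have [_ ->] := hS x.
have hdS := hasdx_dqscore v B.
split.
- move=> x; split => [|i]; first by have [] := hS x.
  by rewrite dxS; have [] := hdS i x.
- move=> x; rewrite dtheta_pdens// -/v -/E -(qscore_pde v x BT ET h).
  apply: eq_bigr => i _; rewrite dxS.
  by have [_ ->] := hasdxM (hasdx_pdens mu sL) (hdS i) x.
- by apply: subexp_sqr_integrable; [exact: subexp_qscore|exact: hasdx_continuous hS].
- move=> i; rewrite dxS; apply: subexp_sqr_integrable; first exact: subexp_dqscore.
  exact: hasdx_continuous (hdS i).
- by have [] := qscore_mean0 v BT.
Qed.

Lemma wscore_unique k S B : let E := (pdir R k).2 in
  B^T = B -> E^T = E -> A *m B + B *m A = L *m E + E *m L ->
  wscore (@gauss R d) k mu L S -> S = qscore (pdir R k).1 B.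
Proof.
set v := (pdir R k).1 => E BT ET h [dS pdeS S2 dS2 S0].
pose q := qscore v B.
have hp := hasdx_pdens mu sL.
have pos := pdens_gt0 mu sL.
have cp := @continuous_pdens R d mu L sL.
have hS : hasdx S (fun i => dx i S) by apply: hasdx_differentiable => x; have [] := dS x.
have hdS i : hasdx (dx i S) (fun j => dx j (dx i S)).
  by apply: hasdx_differentiable => x; have [_] := dS x; apply.
have hq := hasdx_qscore v BT.
have pdeS' x := etrans (etrans (esym (eq_bigr _
    (fun i _ => (hasdxM hp (hdS i) x).2 i))) (pdeS x)) (congr1 -%R (dtheta_pdens mu sL k x)).
have cq := hasdx_continuous hq.
have hcst := div_grad_unique pos hp hS hdS hq (hasdx_dqscore v B) pdeS'
  (fun x => qscore_pde v x BT ET h) S2 (subexp_sqr_integrable (subexp_qscore v B) cq)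
  dS2 (fun i => subexp_sqr_integrable (subexp_dqscore v B i) (hasdx_continuous (hasdx_dqscore v B i))).
pose c := S 0 - q 0.
have SE : S = fun x => q x + c by apply/funext => x; rewrite /c -(hcst x) -/q; ring.
(* Only now does [S] have controlled growth, so that its vanishing [iint] is a limit of cube
   integrals. *)
have sS : subexp S by rewrite SE; apply: subexpD; [exact: subexp_qscore|exact: subexp_cst].
have [l lE lim] := gauss_iint sS (hasdx_continuous hS).
have l0 : l = 0 by move: lE; rewrite S0 => -[].
have [_ limq] := qscore_mean0 v BT.
pose m := boxI (- 1) 1 p.
have N11 : - 1 <= 1 :> R by lra.
have m0 : 0 < m.
  rewrite lt_neqAle boxI_ge0 ?andbT => [|x _]; last exact: ltW.
  apply/eqP => m0; have z i : - 1 < (0 : 'rV[R]_d) 0 i < 1 by rewrite mxE; lra.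
  have /eqP := boxI_eq0 N11 cp (fun x => ltW (pos x)) (esym m0) z.
  by rewrite gt_eqF.
(* The cube integrals of [S p] and [q p] tend to 0, yet differ by [c] times a mass at least [m].
   With tolerance [|c| * m / 3] for each, [|c| * m] would be at most two thirds of itself. *)
suff c0 : c = 0 by rewrite SE; apply/funext => x; rewrite c0 addr0.
apply/eqP; rewrite -normr_le0 leNgt; apply/negP => c0.
have cm : 0 < `|c| * m / 3 by rewrite divr_gt0// mulr_gt0.
rewrite l0 in lim.
move/cvgr0_norm_le: lim => /(_ _ cm)[N1 _ H1].
move/cvgr0_norm_le: limq => /(_ _ cm)[N2 _ H2].
(* The 1 ensures that the cube contains [[-1, 1]^d], where [m] is measured. *)
pose N := (1 + (N1 + N2))%N.
have h1 := H1 N; have h2 := H2 N.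
have NN : - N%:R <= N%:R :> R by have : 0 <= N%:R :> R by []; lra.
have SN : boxI (- N%:R) N%:R (fun x => S x * p x) =
   boxI (- N%:R) N%:R (fun x => q x * p x) + c * boxI (- N%:R) N%:R p.
  rewrite -boxIZ// -boxID//; first by apply: eq_boxI => x _; rewrite SE; ring.
    exact: continuous_mul.
  by apply: continuous_mul => //; exact: continuous_cst.
have mN : m <= boxI (- N%:R) N%:R p.
  have N1le : 1 <= N%:R :> R by rewrite ler1n.
  by apply: boxI_sub_le => //; [move=> x; exact: ltW|lra].
have := h1 _; have := h2 _; rewrite /= SN.
set b := boxI _ _ _; set b' := boxI _ _ _.
move=> /(_ _)Hq /(_ _)HS.
have {}Hq : `|b| <= `|c| * m / 3 by exact/Hq/(leq_trans (leq_addl N1 N2))/leq_addl.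
have {}HS : `|b + c * b'| <= `|c| * m / 3 by exact/HS/(leq_trans (leq_addr N2 N1))/leq_addl.
have : `|c| * m <= `|c * b'|.
  by rewrite normrM ler_wpM2l// (le_trans mN)// ler_norm.
have := ler_normB (b + c * b') b; rewrite addrAC subrr add0r.
lra.
Qed.

End WassersteinScore.

(** * Estimating equations *)

Section EstimatingEquations.
Context {R : realType} {d n : nat} (X : 'I_n -> 'rV[R]_d) (n0 : n%:R != 0 :> R)
  (mu : 'rV[R]_d) (L : 'M[R]_d) (sL : spd L).
Implicit Types (B E : 'M[R]_d) (v : 'rV[R]_d).

Local Notation A := (L *m L).

(** Centred at the parameter: the equations are averaged before [mu] is known to be the sample
    mean. *)
Definition scatter : 'M[R]_d := n%:R^-1 *: \sum_(t < n) ((X t - mu)^T *m (X t - mu)).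

Lemma scatter_mean : mu = sample_mean X -> scatter = sample_cov X.
Proof. by rewrite /scatter => ->. Qed.

Lemma average_dev : n%:R^-1 *: \sum_(t < n) (X t - mu) = sample_mean X - mu.
Proof.
rewrite sumrB scalerBr; congr (_ - _).
by rewrite sumr_const card_ord -[mu *+ n]scaler_nat scalerA mulVf// scale1r.
Qed.

Lemma average_linear B v :
  n%:R^-1 * \sum_(t < n) ((X t - mu) *m B *m v^T) 0 0 =
  ((sample_mean X - mu) *m B *m v^T) 0 0.
Proof.
rewrite -average_dev -!scalemxAl [RHS]mxE !mulmx_suml summxE.
by [].
Qed.

Lemma average_quad B :
  n%:R^-1 * \sum_(t < n) ((X t - mu) *m B *m (X t - mu)^T) 0 0 = \tr (B *m scatter).
Proof.
rewrite /scatter -scalemxAr mxtraceZ mulmx_sumr raddf_sum; congr (_ * _).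
by apply: eq_bigr => t _; rewrite mx11_quad_tr.
Qed.

Lemma average_cst (c : R) : n%:R^-1 * \sum_(t < n) c = c.
Proof. by rewrite sumr_const card_ord -[c *+ n]mulr_natl mulrA mulVf// mul1r. Qed.

Lemma average_gscore v E : E^T = E -> n%:R^-1 * \sum_(t < n) gscore mu L v E (X t) =
  \tr (invmx L *m E) - \tr (L *m E *m scatter) + ((sample_mean X - mu) *m A *m v^T) 0 0.
Proof.
move=> ET; have [LT _] := sL.
rewrite -average_quad -average_linear -[X in X - _]average_cst -mulrBr -mulrDr.
congr (_ * _); rewrite -sumrB -big_split/=; apply: eq_bigr => t _.
rewrite /gscore.
have -> : \sum_(j < d) clin mu L j (X t) * (clin mu E j (X t) - (v *m L) 0 j) =
    \sum_j clin mu L j (X t) * clin mu E j (X t) - \sum_j clin mu L j (X t) * (v *m L) 0 j.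
  by rewrite -sumrB; apply: eq_bigr => j _; ring.
by rewrite sum_clinM ET (sum_clinMl _ _ (v *m L)) trmx_mul LT !mulmxA opprB addrA addrAC.
Qed.

Lemma average_qscore v B : n%:R^-1 * \sum_(t < n) qscore mu L v B (X t) =
  ((sample_mean X - mu) *m v^T) 0 0 - 2^-1 * (\tr (B *m scatter) - \tr (B *m invmx A)).
Proof.
rewrite -[sample_mean X - mu]mulmx1 -average_linear -average_quad.
rewrite -[X in _ - _ * (_ - X)]average_cst -mulrBr mulrCA -mulrBr.
congr (_ * _); rewrite -sumrB mulr_sumr -sumrB; apply: eq_bigr => t _.
by rewrite /qscore sum_clinMl sum_clinM trmx1 !mulmx1.
Qed.

Lemma trmx_pdir k : ((pdir R (d := d) k).2)^T = (pdir R k).2.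
Proof.
case: k => [i|i j ij] /=; first by rewrite trmx0.
by rewrite linearD /= !trmx_delta addrC.
Qed.

Lemma is_mleE : is_mle (@gauss R d) X mu L <->
  forall k, n%:R^-1 * \sum_(t < n) gscore mu L (pdir R k).1 (pdir R k).2 (X t) = 0.
Proof.
have E k : n%:R^-1 * \sum_(t < n) dtheta (fun m l => ln (pdens (@gauss R d) (X t) m l)) k mu L =
    n%:R^-1 * \sum_(t < n) gscore mu L (pdir R k).1 (pdir R k).2 (X t).
  by congr (_ * _); apply: eq_bigr => t _; rewrite dtheta_ln_pdens.
by split=> h k; have := h k; rewrite E.
Qed.

(** Uniqueness of the score removes the existential over [S]. Existence of a Lyapunov solution,
    symmetric by [lyapunov_sym], gives the converse. *)
Lemma is_westE : is_west (@gauss R d) X mu L <->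
  forall k B, B^T = B ->
    A *m B + B *m A = L *m (pdir R k).2 + (pdir R k).2 *m L ->
    n%:R^-1 * \sum_(t < n) qscore mu L (pdir R k).1 B (X t) = 0.
Proof.
split=> [h k B BT hB|h k].
  have [S [wS]] := h k.
  by rewrite (wscore_unique sL BT (trmx_pdir k) hB wS).
have [B hB] := lyapunov_exists (L *m (pdir R k).2 + (pdir R k).2 *m L) (spd_sqr sL).
have BT : B^T = B.
  apply: (lyapunov_sym (spd_sqr sL)); rewrite hB linearD /= !trmx_mul trmx_pdir.
  by have [-> _] := sL; rewrite addrC.
exists (qscore mu L (pdir R k).1 B); split; last exact: h.
exact: wscore_qscore (trmx_pdir k) hB.
Qed.

Lemma tr_pdir_eq0 (Z : 'M[R]_d) : Z^T = Z ->
  (forall (i j : 'I_d) (ij : (i <= j)%N), \tr ((pdir R (@PLam d i j ij)).2 *m Z) = 0) -> Z = 0.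
Proof. by move=> ZT h; apply: sym_tr_delta_eq0. Qed.

Lemma trmx_scatter : scatter^T = scatter.
Proof.
rewrite /scatter linearZ /= linear_sum; congr (_ *: _).
by apply: eq_bigr => t _; rewrite /= trmx_mul trmxK.
Qed.

Lemma mulmx_delta_tr (w : 'rV[R]_d) i : (w *m (delta_mx 0 i : 'rV[R]_d)^T) 0 0 = w 0 i.
Proof.
rewrite mxE (bigD1 i)//= [X in _ + X]big1 ?addr0.
  by rewrite !mxE !eqxx mulr1.
by move=> j ji; rewrite !mxE (negbTE ji) andbF mulr0.
Qed.

Lemma is_mle_gaussE :
  is_mle (@gauss R d) X mu L <-> mu = sample_mean X /\ A *m sample_cov X = 1%:M.
Proof.
have uA := spd_unitmx (spd_sqr sL); have uL := spd_unitmx sL; have [LT _] := sL.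
have iAE : invmx A = invmx L *m invmx L.
  by apply: (can_inj (mulKmx uA)); rewrite mulmxV// mulmxA mulmxK// mulmxV.
rewrite is_mleE; split=> [h|[muE AS] k]; last first.
  rewrite average_gscore ?trmx_pdir// -muE subrr !mul0mx mxE addr0 scatter_mean//.
  have -> : sample_cov X = invmx A by apply: (can_inj (mulKmx uA)); rewrite AS mulmxV.
  by rewrite iAE [X in _ - X]mxtrace_mulC -[_ *m (L *m _)]mulmxA mulKmx// subrr.
have muE : mu = sample_mean X.
  apply/eqP; rewrite eq_sym -subr_eq0; apply/eqP.
  suff w0 : (sample_mean X - mu) *m A = 0.
    by rewrite -[LHS](mulmxK uA) w0 mul0mx.
  apply/rowP => i; have := h (PMu i).
  rewrite average_gscore /= ?trmx0// !mulmx0 mul0mx !mxtrace0 subrr add0r mulmx_delta_tr => ->.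
  by rewrite mxE.
split=> //; rewrite -scatter_mean//; set S := scatter.
have ST : S^T = S := trmx_scatter.
(* The likelihood equations read [\tr (E *m Z) = 0] for symmetric [E], so they determine only
   [Z + Z^T], which is minus the Lyapunov expression of [S - invmx A] with respect to [L]. *)
pose Z := invmx L - S *m L.
have ZZ : Z + Z^T = 0.
  apply: tr_pdir_eq0 => [|i j ij]; first by rewrite linearD /= trmxK addrC.
  have := h (PLam ij); set E := (pdir R _).2.
  have ET : E^T = E := trmx_pdir _.
  rewrite average_gscore// -muE subrr !mul0mx mxE addr0 -/S => hE.
  rewrite mulmxDr mxtraceD -[X in _ + X]mxtrace_tr trmx_mul trmxK ET [X in _ + X]mxtrace_mulC.
  suff -> : \tr (E *m Z) = 0 by rewrite addr0.
  rewrite /Z mulmxBr linearB /= [X in X - _]mxtrace_mulC.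
  by rewrite [X in _ - X]mxtrace_mulC -[S *m L *m E]mulmxA [X in _ - X]mxtrace_mulC.
have M0 : S - invmx A = 0.
  apply: (lyapunov_inj sL).
  rewrite mulmxBr mulmxBl iAE mulKVmx// -mulmxA mulVmx// mulmx1.
  move: ZZ; rewrite /Z linearB /= trmx_mul LT ST trmx_inv LT => ZZ.
  by apply/eqP; rewrite -oppr_eq0 opprD !opprB addrC ZZ.
have -> : S = invmx A by apply/eqP; rewrite -subr_eq0 M0.
exact: mulmxV.
Qed.

Lemma is_west_gaussE :
  is_west (@gauss R d) X mu L <-> mu = sample_mean X /\ A *m sample_cov X = 1%:M.
Proof.
have sA := spd_sqr sL; have uA := spd_unitmx sA; have [LT _] := sL; have [AT _] := sA.
rewrite is_westE; split=> [h|[muE AS] k B BT hB]; last first.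
  rewrite average_qscore -muE subrr mul0mx mxE add0r scatter_mean//.
  have -> : sample_cov X = invmx A by apply: (can_inj (mulKmx uA)); rewrite AS mulmxV.
  by rewrite subrr mulr0 oppr0.
have muE : mu = sample_mean X.
  apply/eqP; rewrite eq_sym -subr_eq0; apply/eqP/rowP => i.
  have := h (PMu i) 0; rewrite /= !mulmx0 !mul0mx trmx0 => /(_ erefl erefl).
  rewrite average_qscore !mul0mx subrr mulr0 subr0 mulmx_delta_tr => ->.
  by rewrite mxE.
split=> //; rewrite -scatter_mean//; set S := scatter.
have ST : S^T = S := trmx_scatter.
pose M := S - invmx A.
have MT : M^T = M by rewrite linearB /= ST trmx_inv AT.
have [N hN] := lyapunov_exists M sA.
have NT : N^T = N by apply: (lyapunov_sym sA); rewrite hN.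
(* The adjoint of the solution map E |-> B is E |-> N L + L N. *)
have NL : N *m L + L *m N = 0.
  apply: tr_pdir_eq0 => [|i j ij].
    by rewrite linearD /= !trmx_mul LT NT addrC.
  set E := (pdir R _).2.
  have ET : E^T = E := trmx_pdir _.
  have [B hB] := lyapunov_exists (L *m E + E *m L) sA.
  have BT : B^T = B.
    by apply: (lyapunov_sym sA); rewrite hB linearD /= !trmx_mul ET LT addrC.
  have := h (PLam ij) B BT hB.
  rewrite average_qscore -muE subrr mul0mx mxE add0r -/S => hBM.
  (* The Lyapunov operator of [A] is self-adjoint for the trace form, so it can be moved from [N] to
     [B], where it yields [L *m E + E *m L]. *)
  have hM : \tr (B *m (A *m N + N *m A)) = 0.
    by rewrite hN /M mulmxBr linearB /=; lra.
  have t1 : \tr (L *m E *m N) = \tr (E *m (N *m L)).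
    by rewrite -mulmxA mxtrace_mulC -mulmxA.
  have t2 : \tr (B *m (N *m A)) = \tr (A *m B *m N).
    by rewrite -[A *m B *m N]mulmxA [RHS]mxtrace_mulC -[B *m N *m A]mulmxA.
  transitivity (\tr ((L *m E + E *m L) *m N)).
    by rewrite mulmxDr mulmxDl !mxtraceD t1 -[E *m L *m N]mulmxA.
  by rewrite -hB -hM mulmxDl mulmxDr !mxtraceD t2 -[B *m A *m N]mulmxA addrC.
have N0 : N = 0 by apply: (lyapunov_inj sL); rewrite addrC.
have M0 : M = 0 by rewrite -hN N0 mulmx0 mul0mx addr0.
have -> : S = invmx A by apply/eqP; rewrite -subr_eq0 -/M M0.
exact: mulmxV.
Qed.

End EstimatingEquations.

(** For an empty sample the convention [0^-1 = 0] makes the sample covariance the zero matrix, which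
    is not positive definite in positive dimension. *)
Lemma spd_sample_cov_neq0 (R : realType) (d n : nat) (X : 'I_n -> 'rV[R]_d.+1) :
  spd (sample_cov X) -> n%:R != 0 :> R.
Proof.
move=> [_ S0]; apply/negP => /eqP n0.
have v0 : (const_mx 1 : 'rV[R]_d.+1) != 0.
  by apply/eqP => /rowP/(_ ord0); rewrite !mxE => /eqP; rewrite oner_eq0.
have := S0 _ v0; rewrite /sample_cov n0 invr0 scale0r.
by rewrite mulmx0 mul0mx mxE ltxx.
Qed.
Unset Implicit Arguments.

(** For positive definite [L], the matrix equation says that [L] is the inverse square root of the
    sample covariance. *)
Theorem mainTheorem4 (R : realType) (d n : nat) (X : 'I_n -> 'rV[R]_d) :
  spd (sample_cov X) ->
  forall (mu : 'rV[R]_d) (L : 'M[R]_d), spd L ->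
    (is_mle (@gauss R d) X mu L <->
       (mu = sample_mean X /\ L *m L *m sample_cov X = 1%:M)) /\
    (is_west (@gauss R d) X mu L <->
       (mu = sample_mean X /\ L *m L *m sample_cov X = 1%:M)).
Proof.
case: d X => [|d] X sS mu L sL.
  (* In dimension 0 the sample may be empty, but there are no parameter coordinates and all matrices
     coincide, so both sides hold trivially. *)
  have rhs : mu = sample_mean X /\ L *m L *m sample_cov X = 1%:M.
    by split; [apply/rowP|apply/matrixP] => -[].
  by split; split=> // _; do 2?case.
have n0 := spd_sample_cov_neq0 sS.
by split; [exact: is_mle_gaussE|exact: is_west_gaussE].
Qed.
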